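(* If $(\Omega,\varphi)$ is an ordinary semicascade whose proximality relation $\mathrm{P}(\Omega,\varphi)$ is transitive, then all ergodic operator nets $T_\alpha\in G_0$ converge in the $\mathrm{W}^*\mathrm{O}$-topology. If $(\Omega,\varphi)$ is a tame semicascade whose proximality relation $\mathrm{P}(\Omega,\varphi)$ is transitive, then all ergodic operator sequences $T_n\in G_0$ converge in the $\mathrm{W}^*\mathrm{O}$-topology.
   Context: $\Omega$ is a metrizable compact space and $\varphi:\Omega\to\Omega$ is a continuous (not necessarily invertible) map; $(\Omega,\varphi)$ is the corresponding semicascade. $X=C(\Omega)$ is the Banach space of continuous scalar functions, $X^*$ its dual (Borel measures on $\Omega$), with pairing $(x,\mu)=\int_\Omega x\,d\mu$. $U\in\mathrm{End}\,X$ is $(Ux)(\omega)=x(\varphi\omega)$, $V=U^*\in\mathrm{End}\,X^*$, $I$ is the identity; $\mathrm{End}$ denotes bounded linear operators. The $\mathrm{W}^*\mathrm{O}$-topology on $\mathrm{End}\,X^*$: $T_\alpha\to T$ iff $(x,T_\alpha y)\to(x,Ty)$ for all $x\in X$, $y\in X^*$. $G_0=\mathrm{co}\{V^n:n\ge 0\}$ (convex hull). A net (or sequence) of operators $T_\alpha\in G_0$ is ergodic if $T_\alpha(I-V)\to 0$ in the $\mathrm{W}^*\mathrm{O}$-topology. The enveloping semigroup $E(\Omega,\varphi)$ is the closure of $\{\varphi^n:n\ge 0\}$ in $\Omega^\Omega$ with the topology of pointwise convergence; $(\Omega,\varphi)$ is ordinary if $E(\Omega,\varphi)$ is metrizable.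 The semicascade is tame if, for each $x\in C(\Omega)$ and each increasing sequence $\{n(k)\}$ of positive integers, $\inf_a\|\sum_{k\ge 1}a_kx_{n(k)}\|_{C(\Omega)}=0$, where $x_n(\omega)=x(\varphi^n\omega)$ and the infimum is over finite (finitely supported) real sequences $a=\{a_k\}$ with $\sum_k|a_k|=1$. Points $\omega_1,\omega_2\in\Omega$ are proximal, written $(\omega_1,\omega_2)\in\mathrm{P}(\Omega,\varphi)$, if $\inf_{n\ge0}\rho(\varphi^n\omega_1,\varphi^n\omega_2)=0$, where $\rho$ is a fixed metric compatible with the topology of $\Omega$. Transitivity means that $\mathrm{P}(\Omega,\varphi)$ is an equivalence relation. *)

(* Defs.v *)
From HB Require Import structures.
From Corelib Require RelationClasses.
From mathcomp Require Import all_boot all_order all_algebra.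
From mathcomp Require Import all_classical all_reals all_analysis.
From mathcomp Require Import complex.

Set Implicit Arguments.
Unset Strict Implicit.
Unset Printing Implicit Defensive.

Import Order.TTheory GRing.Theory Num.Theory.
Import numFieldNormedType.Exports.

Local Open Scope classical_set_scope.
Local Open Scope ring_scope.

(** The statement is made for both real and complex scalars. Following the
    convention of normedModType, norms take their values in the scalar field. *)
Inductive scalars := RealScalars | ComplexScalars.

Definition scalarField (R : realType) (s : scalars) : numFieldType :=
  match s with RealScalars => R | ComplexScalars => R[i] end.

Section nonnegative_suprema.
Context {R : realType} {s : scalars}.
Local Notation K := (scalarField R s).
Implicit Type A : set K.

Lemma scalarField_supremums A : A !=set0 -> A `<=` [set x | 0 <= x] ->
  ubound A !=set0 -> supremums A !=set0.
Proof.
case: s A => /= A [a Aa] A0 [M ubM].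
  exists (sup A); have hsA : has_sup A by split; [exists a|exists M].
  by split=> [x Ax|b ub]; [exact: (sup_upper_bound hsA)|apply: sup_le_ub => //; exists a].
pose B := [set complex.Re z | z in A].
have hsB : has_sup B.
  split; first by exists (complex.Re a), a.
  by exists (complex.Re M) => _ [z Az <-]; have := ubM _ Az; rewrite lecE => /andP[].
have AE z : A z -> complex.Im z = 0.
  by move=> /A0 /=; rewrite lecE => /andP[/eqP].
exists ((sup B)%:C)%C; split=> [z Az|b ub].
  rewrite lecE/= (AE _ Az) eqxx/=; apply: (sup_upper_bound hsB); by exists z.
have := ub _ Aa; rewrite !lecE/= (AE _ Aa) => /andP[-> _] /=.
apply: sup_le_ub; first by exists (complex.Re a), a.
by move=> _ [z Az <-]; have := ub _ Az; rewrite lecE => /andP[].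
Qed.

Section bounded_set.
Variable A : set K.
Hypothesis A_ge0 : A `<=` [set x | 0 <= x].
Hypothesis A_ub : ubound A !=set0.

Let supremumP : A !=set0 -> supremums A (supremum 0 A).
Proof.
move=> A0; rewrite /supremum; case: ifPn => [/eqP AE|_].
  by move: A0; rewrite AE => -[].
by apply: xgetPex; exact: scalarField_supremums.
Qed.

Lemma scalarField_sup_ub x : A x -> x <= supremum 0 A.
Proof. by move=> Ax; have [+ _] := supremumP (ex_intro _ x Ax); apply. Qed.

Lemma scalarField_sup_ge0 : 0 <= supremum 0 A.
Proof.
have [->|/set0P[x Ax]] := eqVneq A set0; first by rewrite supremum0.
exact: le_trans (A_ge0 Ax) (scalarField_sup_ub Ax).
Qed.

Lemma scalarField_sup_le b : 0 <= b -> ubound A b -> supremum 0 A <= b.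
Proof.
move=> b0 ub; have [->|/set0P A0] := eqVneq A set0; first by rewrite supremum0.
by have [_ +] := supremumP A0; apply.
Qed.

End bounded_set.
End nonnegative_suprema.

Section continuous_functions.
Context {R : realType} (s : scalars) {Omega : metricType R}.
Local Notation K := (scalarField R s).

Definition contfun_pred : {pred Omega -> K} :=
  [pred x : Omega -> K | `[< continuous x >]].

Lemma contfun_submod_closed : submod_closed contfun_pred.
Proof.
split; first by apply/asboolP => w; exact: cvg_cst.
move=> a x y /asboolP cx /asboolP cy; apply/asboolP => w.
apply: (@cvgD K K) => //; last exact: cy.
by apply: (@cvgZr K K) => //; exact: cx.
Qed.

HB.instance Definition _ :=
  GRing.isSubmodClosed.Build K (Omega -> K) contfun_pred contfun_submod_closed.

Record contfun (cptO : compact [set: Omega]) := ContFun {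
  contfun_val :> Omega -> K;
  contfun_valP : contfun_val \in contfun_pred }.
End continuous_functions.
Arguments ContFun {R s Omega cptO}.

Section continuous_functions_lmod.
Context {R : realType} {s : scalars} {Omega : metricType R}.
Context {cptO : compact [set: Omega]}.
Local Notation K := (scalarField R s).
Local Notation X := (contfun s cptO).

HB.instance Definition _ := [isSub for @contfun_val R s Omega cptO].
HB.instance Definition _ := [Choice of X by <:].
HB.instance Definition _ := [SubChoice_isSubLmodule of X by <:].

Definition supnorm (x : X) : K := supremum 0 (range (fun w => `|x w|)).

Let norms_ge0 (x : X) : range (fun w => `|x w|) `<=` [set c | 0 <= c].
Proof. by move=> _ [w _ <-] /=. Qed.

Lemma contfun_continuous (x : X) : continuous x.
Proof. by have /asboolP := contfun_valP x. Qed.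

Let norms_ub (x : X) : ubound (range (fun w => `|x w|)) !=set0.
Proof.
have : \forall M \near +oo_K, [set: Omega] `<=` [set w | `|x w| <= M].
  move/compact_near_coveringP : cptO; apply=> w _.
  near=> w' M; rewrite /= -[x w'](subrK (x w)).
  apply: le_trans (ler_normD _ _) _; apply: (@le_trans _ _ (1 + `|x w|)).
    rewrite lerD2r; near: w'.
    have /cvgrPdist_le /(_ 1 ltr01) := @contfun_continuous x w.
    by apply: filterS => w'; rewrite distrC.
  by near: M; apply: nbhs_pinfty_ge; rewrite realD ?real1 ?normr_real.
move=> /pinfty_ex_gt0[M M0 xM]; exists M => _ [w _ <-]; exact: xM.
Unshelve. all: by end_near. Qed.

Lemma le_supnorm (x : X) w : `|x w| <= supnorm x.
Proof. by apply: scalarField_sup_ub => //; exists w. Qed.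

Lemma supnorm_le (x : X) c : 0 <= c -> (forall w, `|x w| <= c) -> supnorm x <= c.
Proof. by move=> c0 xc; apply: scalarField_sup_le => // _ [w _ <-]. Qed.

Lemma supnorm_ge0 (x : X) : 0 <= supnorm x.
Proof. exact: scalarField_sup_ge0. Qed.

Lemma supnormD (x y : X) : supnorm (x + y) <= supnorm x + supnorm y.
Proof.
apply: supnorm_le => [|w]; first by rewrite addr_ge0 ?supnorm_ge0.
by apply: le_trans (ler_normD _ _) _; rewrite lerD ?le_supnorm.
Qed.

Let supnormZ_le (a : K) (x : X) : supnorm (a *: x) <= `|a| * supnorm x.
Proof.
apply: supnorm_le => [|w]; first by rewrite mulr_ge0 ?supnorm_ge0.
by rewrite [X in `|X|](_ : _ = a * x w)// normrM ler_wpM2l ?le_supnorm.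
Qed.

Lemma supnormZ (a : K) (x : X) : supnorm (a *: x) = `|a| * supnorm x.
Proof.
apply/eqP; rewrite eq_le supnormZ_le/=.
have [->|a0] := eqVneq a 0; first by rewrite normr0 mul0r supnorm_ge0.
rewrite -ler_pdivlMl ?normr_gt0// -normfV.
by rewrite -{1}[x](scalerK a0); exact: supnormZ_le.
Qed.

Lemma supnorm_eq0 (x : X) : supnorm x = 0 -> x = 0.
Proof.
move=> x0; apply: val_inj; apply/funext => w; apply/eqP.
by rewrite -normr_le0 -x0 le_supnorm.
Qed.

HB.instance Definition _ :=
  Lmodule_isNormed.Build K X supnormD supnormZ supnorm_eq0.

End continuous_functions_lmod.

Section dual_space.
Context {R : realType} {s : scalars}.
Local Notation K := (scalarField R s).
Variable X : normedModType K.

Definition dual_pred : {pred X -> K} :=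
  [pred f : X -> K | `[< scalar f /\ continuous f >]].

Lemma dual_submod_closed : submod_closed dual_pred.
Proof.
split; first by apply/asboolP; split=> [a x y|x];
  [rewrite mulr0 addr0|exact: cvg_cst].
move=> a f g /asboolP[lf cf] /asboolP[lg cg]; apply/asboolP; split=> [b x y|x].
  rewrite [LHS](_ : _ = a * f (b *: x + y) + g (b *: x + y))//.
  rewrite [RHS](_ : _ = b * (a * f x + g x) + (a * f y + g y))//.
  by rewrite lf lg !mulrDr !mulrA (mulrC a b) addrACA.
apply: (@cvgD K K) => //; last exact: cg.
by apply: (@cvgZr K K) => //; exact: cf.
Qed.

HB.instance Definition _ :=
  GRing.isSubmodClosed.Build K (X -> K) dual_pred dual_submod_closed.

Record dual := Dual { dual_val :> X -> K; dual_valP : dual_val \in dual_pred }.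

HB.instance Definition _ := [isSub for dual_val].
HB.instance Definition _ := [Choice of dual by <:].
HB.instance Definition _ := [SubChoice_isSubLmodule of dual by <:].

Lemma dual_linear (f : dual) : scalar f.
Proof. by have /asboolP[] := dual_valP f. Qed.

Lemma dual_continuous (f : dual) : continuous f.
Proof. by have /asboolP[] := dual_valP f. Qed.

Definition dualnorm (f : dual) : K :=
  supremum 0 [set `|f x| | x in [set x : X | `|x| <= 1]].

Let norms_ge0 (f : dual) :
  [set `|f x| | x in [set x : X | `|x| <= 1]] `<=` [set c | 0 <= c].
Proof. by move=> _ [x _ <-] /=. Qed.

Let norms_ub (f : dual) :
  ubound [set `|f x| | x in [set x : X | `|x| <= 1]] !=set0.
Proof.
pose g := @dual_val f.
pose glin := GRing.isLinear.Build K X K *%R g (dual_linear f).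
pose h : {linear X -> K} := HB.pack g glin.
have : bounded_near h (nbhs 0).
  by apply/linear_bounded_continuous; exact: dual_continuous.
move=> /linear_boundedP /pinfty_ex_gt0[M M0 fM].
exists M => _ [x x1 <-]; apply: le_trans (fM x) _.
by rewrite -[leRHS]mulr1 ler_wpM2l// ltW.
Qed.

Lemma dualnorm_ge0 (f : dual) : 0 <= dualnorm f.
Proof. exact: scalarField_sup_ge0. Qed.

Lemma dualnorm_le (f : dual) c :
  0 <= c -> (forall x, `|x| <= 1 -> `|f x| <= c) -> dualnorm f <= c.
Proof. by move=> c0 fc; apply: scalarField_sup_le => // _ [x x1 <-]; exact: fc. Qed.

Let le_dualnorm1 (f : dual) x : `|x| <= 1 -> `|f x| <= dualnorm f.
Proof. by move=> x1; apply: scalarField_sup_ub => //; exists x. Qed.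

Let dualZ (f : dual) a x : f (a *: x) = a * f x.
Proof.
have f0 : f 0 = 0.
  have /eqP := dual_linear f 1 0 0.
  by rewrite scaler0 addr0 mul1r eq_sym -subr_eq0 addrK => /eqP.
by have := dual_linear f a x 0; rewrite f0 !addr0.
Qed.

Lemma le_dualnorm (f : dual) x : `|f x| <= dualnorm f * `|x|.
Proof.
have [->|x0] := eqVneq x 0.
  have := dualZ f 0 0; rewrite scale0r mul0r => ->.
  by rewrite !normr0 mulr0.
rewrite -ler_pdivrMr ?normr_gt0// mulrC.
rewrite -[X in X * _]ger0_norm ?invr_ge0// -normrM -dualZ; apply: le_dualnorm1.
by rewrite normrZ ger0_norm ?invr_ge0// mulVf ?normr_eq0.
Qed.

Lemma dualnormD (f g : dual) : dualnorm (f + g) <= dualnorm f + dualnorm g.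
Proof.
apply: dualnorm_le => [|x x1]; first by rewrite addr_ge0 ?dualnorm_ge0.
by apply: le_trans (ler_normD _ _) _; rewrite lerD ?le_dualnorm1.
Qed.

Let dualnormZ_le (a : K) (f : dual) : dualnorm (a *: f) <= `|a| * dualnorm f.
Proof.
apply: dualnorm_le => [|x x1]; first by rewrite mulr_ge0 ?dualnorm_ge0.
by rewrite [X in `|X|](_ : _ = a * f x)// normrM ler_wpM2l ?le_dualnorm1.
Qed.

Lemma dualnormZ (a : K) (f : dual) : dualnorm (a *: f) = `|a| * dualnorm f.
Proof.
apply/eqP; rewrite eq_le dualnormZ_le/=.
have [->|a0] := eqVneq a 0; first by rewrite normr0 mul0r dualnorm_ge0.
rewrite -ler_pdivlMl ?normr_gt0// -normfV.
by rewrite -{1}[f](scalerK a0); exact: dualnormZ_le.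
Qed.

Lemma dualnorm_eq0 (f : dual) : dualnorm f = 0 -> f = 0.
Proof.
move=> f0; apply: val_inj; apply/funext => x; apply/eqP.
by rewrite -normr_le0 (le_trans (le_dualnorm f x))// f0 mul0r.
Qed.

HB.instance Definition _ :=
  Lmodule_isNormed.Build K dual dualnormD dualnormZ dualnorm_eq0.

(** With X = C(Omega), elements of the dual stand for Borel measures through
    the Riesz representation, f x being the integral of x. *)
Definition pairing (x : X) (f : dual) : K := f x.

(** Operators on the dual are plain functions, so that they form an lmodType
    over K; membership in End X^* is the predicate [bounded_operator], as a
    linear map between normed spaces is bounded iff it is continuous. *)
Definition bounded_operator (T : dual -> dual) : Prop :=
  linear T /\ continuous T.

Definition wstaro_cvg (I : Type) (F : set_system I)
    (T_ : I -> dual -> dual) (T : dual -> dual) : Prop :=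
  forall (x : X) (f : dual),
    pairing x (T_ i f) @[i --> F] --> pairing x (T f).

Definition wstaro_convergent (I : Type) (F : set_system I)
    (T_ : I -> dual -> dual) : Prop :=
  exists2 T, bounded_operator T & wstaro_cvg F T_ T.

End dual_space.

Definition convex_hull (K : numFieldType) (E : lmodType K) (A : set E) : set E :=
  [set v | exists n (a : 'I_n -> K) (u : 'I_n -> E),
    [/\ forall i, 0 <= a i, \sum_i a i = 1, forall i, A (u i)
      & v = \sum_i a i *: u i]].

Definition directed (I : Type) (le : I -> I -> Prop) : Prop :=
  [/\ inhabited I, forall i, le i i,
      forall i j k, le i j -> le j k -> le i k
    & forall i j, exists k, le i k /\ le j k].

(** Convergence of a net indexed by a directed set is convergence along the
    filter generated by the tails. *)
Definition tails (I : Type) (le : I -> I -> Prop) : set_system I :=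
  filter_from setT (fun i => [set j | le i j]).

Definition metrizable (R : realType) (T : topologicalType) : Prop :=
  exists d : T -> T -> R,
    [/\ forall x, d x x = 0,
        forall x y, d x y = 0 -> x = y,
        forall x y, d x y = d y x,
        forall x y z, d x z <= d x y + d y z
      & forall x, nbhs x = filter_from [set e | 0 < e]
                             (fun e => [set y | d x y < e])].

Section semicascade.
Context {R : realType} {Omega : metricType R}.
Variable phi : continuousType Omega Omega.

Definition enveloping_semigroup : set {ptws Omega -> Omega} :=
  closure (range (fun n => iter n phi : {ptws Omega -> Omega})).

Definition ordinary : Prop := metrizable R (set_type enveloping_semigroup).

Definition proximal (w1 w2 : Omega) : Prop :=
  inf (range (fun n => mdist (iter n phi w1) (iter n phi w2))) = 0.

Section operators.
Context (s : scalars) (cptO : compact [set: Omega]).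
Local Notation K := (scalarField R s).
Local Notation X := (contfun s cptO).

Lemma koopman_subproof (x : X) : x \o phi \in @contfun_pred R s Omega.
Proof.
apply/asboolP => w; apply: continuous_comp; first exact: cts_fun.
exact: contfun_continuous.
Qed.

Definition koopman (x : X) : X := ContFun (x \o phi) (koopman_subproof x).

Lemma koopman_linear : linear koopman.
Proof. by move=> a x y; apply: val_inj. Qed.

Lemma koopman_norm_le (x : X) : `|koopman x| <= `|x|.
Proof.
apply: supnorm_le => [|w]; first exact: supnorm_ge0.
exact: (le_supnorm x (phi w)).
Qed.

Lemma koopman_continuous : continuous koopman.
Proof.
pose lin := GRing.isLinear.Build K X X *:%R koopman koopman_linear.
pose U : {linear X -> X} := HB.pack koopman lin.
apply: (@bounded_linear_continuous K X X U).
apply/linear_boundedP; near=> r => x.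
apply: le_trans (koopman_norm_le x) _; rewrite -[leLHS]mul1r ler_wpM2r//.
Unshelve. all: by end_near. Qed.

Lemma koopman_adjoint_subproof (f : dual X) : f \o koopman \in @dual_pred R s X.
Proof.
apply/asboolP; split=> [a x y|x].
  by rewrite /= koopman_linear dual_linear.
by apply: continuous_comp; [exact: koopman_continuous|exact: dual_continuous].
Qed.

Definition koopman_adjoint (f : dual X) : dual X :=
  Dual (koopman_adjoint_subproof f).

Definition G0 : set (dual X -> dual X) :=
  convex_hull (range (fun n => iter n koopman_adjoint)).

Definition ergodic (I : Type) (F : set_system I)
    (T_ : I -> dual X -> dual X) : Prop :=
  wstaro_cvg F (fun i => T_ i \o (idfun - koopman_adjoint)) 0.

(** The coefficients are real even if the scalars are complex, the norms lie in
    K, and "the infimum is 0" says that 0 is a greatest lower bound in K. *)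
Definition tame : Prop :=
  forall (x : X) (n : nat -> nat),
    (forall k, 0 < n k)%N -> {homo n : i j / (i < j)%N} ->
    infimums [set c : K | exists m (a : 'I_m -> K),
      [/\ forall k, a k \is Num.real, \sum_k `|a k| = 1
        & c = `|\sum_(k < m) a k *: iter (n k) koopman x|]] 0.

End operators.
End semicascade.

(* Main.v *)
Require Import Defs.
From Corelib Require RelationClasses.
From mathcomp Require Import all_boot all_order all_algebra.
From mathcomp Require Import all_classical all_reals all_analysis.
From mathcomp Require Import complex ring lra.

(** The functionals on C(Omega) are handled directly, without measures.

    Call a sequence of functions independent if, for some a < b, a subsequence
    realises every pattern of values "above b / below a".  A tame orbit
    (x o phi^n) has no independent subsequence, independence giving the l^1
    lower bound (b - a) / 2.  If the enveloping semigroup E is metrizable,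
    then for every eps the points of Omega fall into countably many classes on
    which all the x o phi^n agree up to eps; an independent sequence would
    separate uncountably many points, so again there is none.

    Absence of independence has two consequences for a positive functional lam.
    If f_n >= 0 tends pointwise to 0 along an ultrafilter, then so does lam f_n;
    and (f_n) is totally bounded for lam |f - g|.  Otherwise an iterated weak
    limit of the truncations of f_n is a positive functional in whose support
    both branches of the independence tree can be prolonged for ever.

    Total boundedness passes to Cesaro means, while an independent sequence is
    not totally bounded for a Bernoulli measure; hence the Cesaro means of an
    orbit are not independent either, and by minimality each minimal set carries
    at most one invariant state.  Transitivity of proximality makes the minimal
    set M of an orbit closure unique (Auslander-Ellis), so some p in E maps the
    whole orbit closure into M, and the first consequence shows that every
    invariant state lives on M.  Thus orbit closures are uniquely ergodic and
    ergodic nets of averages converge pointwise on Omega.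

    Pointwise convergence is upgraded to weak convergence by dominated
    convergence for sequences; for nets in the ordinary case, the countably
    many classes above reduce the Cauchy property to sequences. *)

Set Implicit Arguments.
Unset Strict Implicit.
Unset Printing Implicit Defensive.

Import Order.TTheory GRing.Theory Num.Theory.
Import numFieldNormedType.Exports.

Local Open Scope classical_set_scope.
Local Open Scope ring_scope.

(** * Limits along ultrafilters *)

Section ultralimits.
Context {R : realType} {I : Type} (U : set_system I).
Hypothesis UU : UltraFilter U.
Implicit Types a b : I -> R.

Definition ulim a : R := lim (a i @[i --> U]).

Definition bnd a := exists M, forall i, `|a i| <= M.

(** The image ultrafilter contains the compact segment [[-M, M]], hence converges. *)
Lemma ulimP a : bnd a -> a i @[i --> U] --> ulim a.
Proof.
move=> [M aM]; suff : cvg (a i @[i --> U]) by [].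
have := @segment_compact R (- M) M; rewrite compact_ultra => cM.
have UaU : UltraFilter (a i @[i --> U]).
  split=> [|G GG aG]; first exact: fmap_proper_filter.
  apply/seteqP; split=> A; last exact: aG.
  move=> GA; have [//|UnA] := in_ultra_setVsetC (a @^-1` A) UU.
  have /aG GnA : (a i @[i --> U]) (~` A) by [].
  by have := filter_ex (filterI GA GnA) => -[x []].
have /cM[l [_ al]] : (a i @[i --> U]) [set` `[- M, M]].
  by apply: (@filterE _ U) => i /=; rewrite in_itv/= -ler_norml.
by apply/cvg_ex; exists l.
Qed.

Lemma ulim_eq a l : a i @[i --> U] --> l -> ulim a = l.
Proof. by move=> al; apply: cvg_lim => //; exact: Rhausdorff. Qed.

Lemma near_ulim a e : bnd a -> 0 < e -> \forall i \near U, `|ulim a - a i| < e.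
Proof. by move=> /ulimP /cvgrPdist_lt; apply. Qed.

Lemma near_ulim_gt a c : bnd a -> c < ulim a -> \forall i \near U, c < a i.
Proof.
move=> ba ca; have := near_ulim ba (_ : 0 < ulim a - c); rewrite subr_gt0.
by move=> /(_ ca); apply: filterS => i; rewrite ltr_norml; lra.
Qed.

Lemma near_ulim_lt a c : bnd a -> ulim a < c -> \forall i \near U, a i < c.
Proof.
move=> ba ca; have := near_ulim ba (_ : 0 < c - ulim a); rewrite subr_gt0.
by move=> /(_ ca); apply: filterS => i; rewrite ltr_norml; lra.
Qed.

Lemma ulim_ge a c : bnd a -> (\forall i \near U, c <= a i) -> c <= ulim a.
Proof.
move=> ba ca; rewrite leNgt; apply/negP => /(near_ulim_lt ba) ac.
have [i [/= ac1 ac2]] := filter_ex (filterI ca ac).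
by rewrite ltNge ac1 in ac2.
Qed.

Lemma ulim_le a c : bnd a -> (\forall i \near U, a i <= c) -> ulim a <= c.
Proof.
move=> ba ca; rewrite leNgt; apply/negP => /(near_ulim_gt ba) ac.
have [i [/= ac1 ac2]] := filter_ex (filterI ca ac).
by rewrite ltNge ac1 in ac2.
Qed.

Lemma ulim_cst c : ulim (fun=> c) = c.
Proof. by apply: ulim_eq; exact: cvg_cst. Qed.

Lemma ulimD a b : bnd a -> bnd b ->
  ulim (fun i => a i + b i) = ulim a + ulim b.
Proof. by move=> ba bb; apply: ulim_eq; apply: cvgD; exact: ulimP. Qed.

Lemma ulimB a b : bnd a -> bnd b ->
  ulim (fun i => a i - b i) = ulim a - ulim b.
Proof. by move=> ba bb; apply: ulim_eq; apply: cvgB; exact: ulimP. Qed.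

Lemma ulimM c a : bnd a -> ulim (fun i => c * a i) = c * ulim a.
Proof. by move=> ba; apply: ulim_eq; apply: cvgMr; exact: ulimP. Qed.

Lemma le_ulim a b : bnd a -> bnd b ->
  (\forall i \near U, a i <= b i) -> ulim a <= ulim b.
Proof.
move=> ba bb ab; rewrite leNgt; apply/negP => lt.
pose c := (ulim a + ulim b) / 2.
have /near_ulim_gt-/(_ ba) ac : c < ulim a by rewrite /c; lra.
have /near_ulim_lt-/(_ bb) bc : ulim b < c by rewrite /c; lra.
have [i [/= ? [? ?]]] := filter_ex (filterI ab (filterI ac bc)).
by lra.
Qed.

Lemma ulim_near_norm a c e : bnd a ->
  (\forall i \near U, `|c - a i| <= e) -> `|c - ulim a| <= e.
Proof.
move=> ba ce; rewrite ler_norml; apply/andP; split.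
  suff : ulim a <= c + e by lra.
  by apply: ulim_le => //; apply: filterS ce => i; rewrite ler_norml; lra.
suff : c - e <= ulim a by lra.
by apply: ulim_ge => //; apply: filterS ce => i; rewrite ler_norml; lra.
Qed.

Lemma ulim_norm_le a M : (forall i, `|a i| <= M) -> `|ulim a| <= M.
Proof.
move=> aM; rewrite -normrN -sub0r.
by apply: ulim_near_norm; [exists M|apply: filterE => i; rewrite sub0r normrN].
Qed.

Lemma ulim_dist a b e : bnd a -> bnd b -> (forall i, `|a i - b i| <= e) ->
  `|ulim a - ulim b| <= e.
Proof.
by move=> ba bb ab; rewrite -ulimB//; exact: ulim_norm_le.
Qed.

End ultralimits.

(** * Continuous real functions *)

Section continuity.
Context {R : realType} {T : topologicalType}.
Implicit Types f g : T -> R.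

Lemma contD f g : continuous f -> continuous g -> continuous (f + g).
Proof. by move=> cf cg x; apply: (@cvgD R R); [exact: cf|exact: cg]. Qed.

Lemma contN f : continuous f -> continuous (- f).
Proof. by move=> cf x; apply: (@cvgN R R); exact: cf. Qed.

Lemma contM f g : continuous f -> continuous g -> continuous (f * g).
Proof. by move=> cf cg x; apply: (@cvgM R); [exact: cf|exact: cg]. Qed.

Lemma cont_cst (c : R) : continuous (cst c : T -> R).
Proof. by move=> x; exact: cvg_cst. Qed.

Lemma cont1 : continuous (1 : T -> R).
Proof. by move=> x; exact: cvg_cst. Qed.

Lemma contZ (c : R) f : continuous f -> continuous (c *: f).
Proof. by move=> cf; apply: (@contM (cst c)) => //; exact: cont_cst. Qed.

Lemma cont_sum (J : Type) (r : seq J) (u : J -> T -> R) :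
  (forall j, continuous (u j)) -> continuous (\sum_(j <- r) u j).
Proof.
move=> cu; elim/big_ind : _ => [|f g cf cg|j _]; [exact: cont_cst| |exact: cu].
exact: contD.
Qed.

Lemma cont_norm f : continuous f -> continuous (fun x => `|f x|).
Proof. by move=> cf x; apply: cvg_norm; exact: cf. Qed.

Lemma cont_max f g : continuous f -> continuous g -> continuous (f \max g).
Proof. by move=> cf cg x; apply: continuous_max; [exact: cf|exact: cg]. Qed.

Lemma cont_min f g : continuous f -> continuous g -> continuous (f \min g).
Proof. by move=> cf cg x; apply: continuous_min; [exact: cf|exact: cg]. Qed.

Lemma cont_bnd f : compact [set: T] -> continuous f -> bnd f.
Proof.
move=> cT cf; have [[x _]|T0] := pselect ([set: T] !=set0); last first.
  by exists 0 => x; exfalso; apply: T0; exists x.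
have [||c _ fc] := @compact_EVT_max _ R (fun x => `|f x|) setT _ cT.
- by exists x.
- by apply: continuous_subspaceT; exact: cont_norm.
by exists `|f c| => y; apply: fc; rewrite inE.
Qed.
End continuity.

Section pointwise.
Context {R : realType} {T : Type}.
Implicit Types f g : T -> R.
Lemma funD f g x : (f + g) x = f x + g x. Proof. by []. Qed.
Lemma funM f g x : (f * g) x = f x * g x. Proof. by []. Qed.
Lemma funN f x : (- f) x = - f x. Proof. by []. Qed.
Lemma fun1 x : (1 : T -> R) x = 1. Proof. by []. Qed.
Lemma funZ c f x : (c *: f) x = c * f x. Proof. by []. Qed.
End pointwise.
Definition funE := (@funD, @funM, @funN, @fun1, @funZ).

Ltac cts := repeat lazymatch goal with
  | |- continuous (_ + _) => apply: contD
  | |- continuous (- _) => apply: contN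
  | |- continuous (_ * _) => apply: contM
  | |- continuous (_ *: _) => apply: contZ
  | |- continuous (fun x => `|_|) => apply: cont_norm
  | |- continuous (_ \max _) => apply: cont_max
  | |- continuous (_ \min _) => apply: cont_min
  | |- continuous (\sum_(_ <- _) _) => apply: cont_sum => ?
  | |- continuous (cst _) => exact: cont_cst
  | |- continuous 1 => exact: cont1
  | |- continuous _ => solve [auto]
  end.

(** * Positive functionals and weak limits *)

Section positive_functionals.
Context {R : realType} {T : topologicalType}.
Implicit Types (f g h w y : T -> R) (Z : set T) (lam : (T -> R) -> R).

(** Functionals take arbitrary functions as arguments, but the laws bind only on continuous ones.
    Testing positivity on [Z] alone encodes a measure carried by the closure of [Z]. *)
Definition posfun Z lam :=
  [/\ forall f g, continuous f -> continuous g -> lam (f + g) = lam f + lam g,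
      forall c f, continuous f -> lam (c *: f) = c * lam f
    & forall f, continuous f -> (forall z, Z z -> 0 <= f z) -> 0 <= lam f].

Section one_functional.
Variables (Z : set T) (lam : (T -> R) -> R).
Hypothesis plam : posfun Z lam.

Lemma pfD f g : continuous f -> continuous g -> lam (f + g) = lam f + lam g.
Proof. by case: plam => + _ _; apply. Qed.

Lemma pfZ c f : continuous f -> lam (c *: f) = c * lam f.
Proof. by case: plam => _ + _; apply. Qed.

Lemma pf_ge0 f : continuous f -> (forall z, Z z -> 0 <= f z) -> 0 <= lam f.
Proof. by case: plam => _ _; apply. Qed.

Lemma pfN f : continuous f -> lam (- f) = - lam f.
Proof. by move=> cf; rewrite -scaleN1r pfZ// mulN1r. Qed.

Lemma pfB f g : continuous f -> continuous g -> lam (f - g) = lam f - lam g.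
Proof. by move=> cf cg; rewrite pfD ?pfN//; cts. Qed.

Lemma le_pf f g : continuous f -> continuous g ->
  (forall z, Z z -> f z <= g z) -> lam f <= lam g.
Proof.
move=> cf cg fg; rewrite -subr_ge0 -pfB//; apply: pf_ge0; first by cts.
by move=> z /fg; rewrite -subr_ge0.
Qed.

Lemma pf_cst c : lam (cst c) = c * lam 1.
Proof.
rewrite -pfZ; last by cts.
by congr lam; apply/funext => x; rewrite !funE mulr1.
Qed.

Lemma pf_sum (J : Type) (r : seq J) (u : J -> T -> R) :
  (forall j, continuous (u j)) ->
  lam (\sum_(j <- r) u j) = \sum_(j <- r) lam (u j).
Proof.
move=> cu; elim: r => [|j r ih]; last by rewrite !big_cons pfD ?ih//; cts.
by rewrite !big_nil -[LHS]/(lam (cst 0)) pf_cst mul0r.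
Qed.

Lemma pf1_ge0 : 0 <= lam 1.
Proof. by apply: pf_ge0 => //; cts. Qed.

Lemma pf_norm f : continuous f -> `|lam f| <= lam (fun x => `|f x|).
Proof.
move=> cf; rewrite ler_norml -pfN; last by cts.
by apply/andP; split; apply: le_pf; cts => z _; [exact: lerNnormlW|exact: ler_norm].
Qed.

Lemma pf_bound f M : continuous f -> (forall z, Z z -> `|f z| <= M) ->
  `|lam f| <= M * lam 1.
Proof.
move=> cf fM; apply: le_trans (pf_norm cf) _; rewrite -pf_cst.
by apply: le_pf; cts => z Zz; exact: fM.
Qed.

Lemma posfunM y : continuous y -> (forall z, Z z -> 0 <= y z) ->
  posfun Z (fun f => lam (y * f)).
Proof.
move=> cy y0; split=> [f g cf cg|c f cf|f cf f0].
- by rewrite mulrDr pfD//; cts.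
- rewrite -pfZ; last by cts.
  by congr lam; apply/funext => x; rewrite !funE; ring.
- by apply: pf_ge0; [cts|move=> z Zz; rewrite mulr_ge0 ?y0 ?f0].
Qed.

End one_functional.

Hypothesis cT : compact [set: T].

Lemma posfun_ulim I (U : set_system I) Z (lam : I -> (T -> R) -> R) :
  UltraFilter U -> (forall i, posfun Z (lam i)) -> bnd (fun i => lam i 1) ->
  (forall f, continuous f -> bnd (fun i => lam i f)) /\
  posfun Z (fun f => ulim U (fun i => lam i f)).
Proof.
move=> UU pl [M lM].
have bl f : continuous f -> bnd (fun i => lam i f).
  move=> cf; have [K fK] := cont_bnd cT cf.
  exists (`|K| * M) => i; apply: le_trans (pf_bound (M := K) (pl i) cf _) _ => //.
  apply: (@le_trans _ _ (`|K| * lam i 1)).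
    by rewrite ler_wpM2r ?ler_norm// (pf1_ge0 (pl i)).
  by rewrite ler_wpM2l// (le_trans _ (lM i))// ler_norm.
split=> //; split=> [f g cf cg|c f cf|f cf f0].
- rewrite -ulimD//; [|exact: bl|exact: bl].
  by congr ulim; apply/funext => i; rewrite (pfD (pl i)).
- by rewrite -ulimM; [congr ulim; apply/funext => i; rewrite (pfZ (pl i))|exact: bl].
- by apply: ulim_ge; [exact: bl|apply: filterE => i; exact: pf_ge0 (pl i) _ _ _].
Qed.

End positive_functionals.

Lemma quadratic_ge0 {R : realType} (A B c : R) : 0 <= A ->
  (forall t, 0 <= t ^+ 2 * A + 2 * t * B + c) -> B ^+ 2 <= A * c.
Proof.
move=> A0 q; have [A00|A0'] := eqVneq A 0.
  rewrite A00 mul0r in q *; have [->|B0] := eqVneq B 0; first by rewrite expr0n.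
  (* For [A = 0] and [B <> 0] the polynomial is affine in [t] and takes the value -1 at this
     point. *)
  have := q (- (c + 1) / (2 * B)); rewrite mulr0 add0r.
  have -> : 2 * (- (c + 1) / (2 * B)) * B + c = -1.
    by field.
  by rewrite ler0N1.
have Ap : 0 < A by rewrite lt_def A0' A0.
have := q (- B / A).
have -> : (- B / A) ^+ 2 * A + 2 * (- B / A) * B + c = (A * c - B ^+ 2) / A.
  by field.
by rewrite pmulr_lge0 ?invr_gt0// subr_ge0.
Qed.

(** * Weak limits in L^2 of a positive functional *)

Section weak_limits.
Context {R : realType} {T : topologicalType}.
Hypothesis cT : compact [set: T].
Variables (Z : set T) (lam : (T -> R) -> R).
Hypothesis plam : posfun Z lam.
Variables (I : Type) (U : set_system I).
Hypothesis UU : UltraFilter U.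
Implicit Types (h w y : T -> R).

(** The weak limit of [u] along [U], kept as a functional of the test function [h] rather than as an
    element of L^2(lam). *)
Definition wlim (u : I -> T -> R) h := ulim U (fun i => lam (u i * h)).

Section one_sequence.
Variables (u : I -> T -> R) (C : R).
Hypothesis cu : forall i, continuous (u i).
Hypothesis uC : forall i z, `|u i z| <= C.

Lemma wlim_bnd h : continuous h -> bnd (fun i => lam (u i * h)).
Proof.
move=> ch; have [M hM] := cont_bnd cT ch; exists (C * `|M| * lam 1) => i.
apply: (pf_bound plam); first by cts.
move=> z _; rewrite normrM ler_pM//; apply: le_trans (hM z) _.
exact: ler_norm.
Qed.

Lemma wlimD f g : continuous f -> continuous g ->
  wlim u (f + g) = wlim u f + wlim u g.
Proof.
move=> cf cg; rewrite /wlim -ulimD; [|exact: wlim_bnd..].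
by congr ulim; apply/funext => i; rewrite mulrDr (pfD plam)//; cts.
Qed.

Lemma wlimZ c f : continuous f -> wlim u (c *: f) = c * wlim u f.
Proof.
move=> cf; rewrite /wlim -ulimM; last exact: wlim_bnd.
congr ulim; apply/funext => i; rewrite -(pfZ plam); last by cts.
by congr lam; apply/funext => x; rewrite !funE; ring.
Qed.

Lemma wlim_posfun : (forall i z, Z z -> 0 <= u i z) -> posfun Z (wlim u).
Proof.
move=> u0; split; [exact: wlimD|exact: wlimZ|move=> f cf f0].
apply: ulim_ge; [exact: wlim_bnd|apply: filterE => i].
by apply: (pf_ge0 plam); [cts|move=> z Zz; rewrite mulr_ge0 ?u0 ?f0].
Qed.

Let q w := lam (w * w) - 2 * wlim u w.
Let K := C ^+ 2 * lam 1.

Lemma pf_sqr_le i : lam (u i * u i) <= K.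
Proof.
apply: le_trans (ler_norm _) _; apply: (pf_bound plam); first by cts.
by move=> z _; rewrite normrM expr2 ler_pM.
Qed.

(** Expanding [lam ((2 u_i - h)^2) >= 0] bounds [lam (u_i h)] by [lam (h^2) / 4 + K], so [q] is
    bounded below and controls [lam (h^2)]. *)
Let q_ge h : continuous h -> lam (h * h) / 2 - 2 * K <= q h.
Proof.
move=> ch; rewrite /q; suff : wlim u h <= lam (h * h) / 4 + K by lra.
apply: ulim_le => //; first exact: wlim_bnd.
apply: filterE => i; have Ki := pf_sqr_le i.
have : 0 <= lam ((2 *: u i - h) * (2 *: u i - h)).
  by apply: (pf_ge0 plam); [cts|move=> z _; rewrite -expr2 sqr_ge0].
rewrite (_ : _ * _ = 4 *: (u i * u i) - 4 *: (u i * h) + h * h); last first.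
  by apply/funext => x; rewrite !funE; ring.
rewrite (pfD plam) ?(pfB plam) ?(pfZ plam); cts.
lra.
Qed.

(* The Riesz representative of the weak limit of [u] in L^2(lam) need not be
   continuous; a near-minimiser of the quadratic functional
   [w |-> lam (w^2) - 2 wlim u w] replaces it. *)
Lemma wlim_approx e B : 0 < e -> 0 <= B -> exists w, [/\ continuous w,
  lam (w * w) <= 4 * K + 2,
  forall t, lam (w * w) - 2 * wlim u w <= t ^+ 2 * lam 1 - 2 * (t * wlim u 1) + e
  & forall h, continuous h -> lam (h * h) <= B -> `|wlim u h - lam (w * h)| <= e].
Proof.
move=> e0 B0.
pose S := [set q w | w in [set w | continuous w]].
have hS : has_inf S.
  split; first by exists (q 0), 0 => //; exact: cont_cst.
  exists (- 2 * K) => _ [w cw <-]; apply: le_trans (q_ge cw).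
  have : 0 <= lam (w * w).
    by apply: (pf_ge0 plam); [cts|move=> z _; rewrite -expr2 sqr_ge0].
  by lra.
(* The slack of the near-minimiser: 1 serves the norm bound, [e] the comparison with constants,
   [e^2 / (B + 1)] the last estimate. *)
pose eta := Num.min 1 (Num.min e (e ^+ 2 / (B + 1))).
have B1 : 0 < B + 1 by lra.
have eta0 : 0 < eta by rewrite !lt_min ltr01 e0 divr_gt0 ?exprn_gt0.
have [_ [w cw <-] wS] := inf_adherent eta0 hS.
have qw h : continuous h -> q w <= q h + eta.
  move=> ch; apply: ltW; apply: lt_le_trans wS _; rewrite lerD2r.
  by apply: ge_inf; [case: hS|exists h].
have qt t : q (cst t) = t ^+ 2 * lam 1 - 2 * (t * wlim u 1).
  rewrite /q; have -> : cst t = t *: (1 : T -> R).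
    by apply/funext => x; rewrite !funE mulr1.
  rewrite wlimZ; last by cts.
  rewrite (_ : _ * _ = t ^+ 2 *: (1 : T -> R)); last first.
    by apply/funext => x; rewrite !funE; ring.
  by rewrite (pfZ plam)//; cts.
exists w; split=> // [|t|h ch hB].
- have := qw _ (@cont_cst R T 0); rewrite qt; have := q_ge cw.
  have : eta <= 1 by rewrite ge_min lexx.
  by lra.
- have := qw _ (@cont_cst R T t); rewrite qt.
  have : eta <= e by rewrite !ge_min lexx orbT.
  by rewrite /q; lra.
- have hh0 : 0 <= lam (h * h).
    by apply: (pf_ge0 plam); [cts|move=> z _; rewrite -expr2 sqr_ge0].
  (* Near-minimality along the line [w + t h] makes [t^2 lam (h^2) + 2 t (lam (w h) - wlim u h) +
     eta] nonnegative for every [t]. *)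
  have : (lam (w * h) - wlim u h) ^+ 2 <= lam (h * h) * eta.
    apply: quadratic_ge0 => // t.
    have cth : continuous (w + t *: h) by cts.
    have := qw _ cth; rewrite /q wlimD; [|by cts..].
    rewrite wlimZ//.
    rewrite (_ : (w + _) * _ = w * w + (2 * t) *: (w * h) + t ^+ 2 *: (h * h));
      last first.
      apply/funext => x; rewrite !funE; ring.
    rewrite !(pfD plam) ?(pfZ plam); cts.
    by lra.
  have : lam (h * h) * eta <= e ^+ 2.
    apply: (@le_trans _ _ ((B + 1) * (e ^+ 2 / (B + 1)))).
      apply: ler_pM => //; [exact: ltW|lra|].
      by rewrite !ge_min lexx !orbT.
    by rewrite mulrC divfK// gt_eqF.
  by rewrite ler_norml; nra.
Qed.

(** If [v] is the weak limit of [u], then [wlim u (u k)] tends along [U] to the squared norm of [v],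
    which is positive once [v] has positive integral. *)
Lemma wlim_gt0 : 0 < wlim u 1 -> \forall k \near U, 0 < wlim u (u k).
Proof.
(* Since [t^2 lam 1 <= t c], comparing [w] with the constant [t] gives [wlim u w > t c / 4]. *)
move=> c0; pose c := wlim u 1; pose t := c / (lam 1 + 1).
have l0 := pf1_ge0 plam.
have t0 : 0 < t by rewrite divr_gt0//; lra.
have tc0 : 0 < t * c by rewrite mulr_gt0.
have e0 : 0 < t * c / 4 by lra.
have K0 : 0 <= K by rewrite mulr_ge0 ?sqr_ge0.
have [w [cw _ /(_ t) qt hw]] := wlim_approx e0 K0.
have tl : t ^+ 2 * lam 1 <= t * c.
  have -> : t * c = t ^+ 2 * (lam 1 + 1).
    by rewrite expr2 -mulrA /t divfK// gt_eqF//; lra.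
  by rewrite ler_wpM2l ?sqr_ge0//; lra.
have ww : 0 <= lam (w * w).
  by apply: (pf_ge0 plam); [cts|move=> z _; rewrite -expr2 sqr_ge0].
rewrite -/c in qt.
have : t * c / 4 < wlim u w by lra.
move=> /(near_ulim_gt UU (wlim_bnd cw)); apply: filterS => k.
have := hw (u k) (@cu k) (pf_sqr_le k).
by rewrite ler_norml (mulrC w); lra.
Qed.

End one_sequence.

(** Both iterated limits equal the inner product in L^2(lam) of the weak limits of [u] and [v]. *)
Lemma wlim_exchange (u v : I -> T -> R) C :
  (forall i, continuous (u i)) -> (forall i, continuous (v i)) ->
  (forall i z, `|u i z| <= C) -> (forall i z, `|v i z| <= C) ->
  ulim U (fun i => wlim v (u i)) = ulim U (fun i => wlim u (v i)).
Proof.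
move=> cu cv uC vC; apply/eqP; rewrite -subr_eq0 -normr_eq0 eq_le normr_ge0 andbT.
apply/ler_addgt0Pl => e e0; rewrite addr0.
pose K := C ^+ 2 * lam 1.
have K0 : 0 <= K by rewrite mulr_ge0 ?sqr_ge0 ?(pf1_ge0 plam).
have e4 : 0 < e / 4 by lra.
have B0 : 0 <= 4 * K + 2 by lra.
have [w [cw wK _ hw]] := wlim_approx cu uC e4 B0.
have [z [cz zK _ hz]] := wlim_approx cv vC e4 B0.
have bu : bnd (fun i => wlim v (u i)).
  exists (C * C * lam 1) => i; apply: ulim_norm_le => j.
  by apply: (pf_bound plam) => [|x _]; [cts|rewrite normrM ler_pM].
have bv : bnd (fun i => wlim u (v i)).
  exists (C * C * lam 1) => i; apply: ulim_norm_le => j.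
  by apply: (pf_bound plam) => [|x _]; [cts|rewrite normrM ler_pM].
(* As [w] and [z] approximate the weak limits of [u] and [v], both iterated limits are compared with
   [lam (w z)], through [wlim v w] and [wlim u z]. *)
have h1 : `|wlim v w - ulim U (fun i => wlim u (v i))| <= e / 4.
  apply: ulim_dist => // [|i]; first exact: wlim_bnd.
  rewrite distrC mulrC; apply: hw => //.
  by apply: le_trans (pf_sqr_le cv vC i) _; rewrite -/K; lra.
have h2 : `|wlim u z - ulim U (fun i => wlim v (u i))| <= e / 4.
  apply: ulim_dist => // [|i]; first exact: wlim_bnd.
  rewrite distrC mulrC; apply: hz => //.
  by apply: le_trans (pf_sqr_le cu uC i) _; rewrite -/K; lra.
have h3 := hw _ cz zK.
have h4 := hz _ cw wK; rewrite mulrC in h4.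
move: h1 h2 h3 h4; rewrite !ler_norml; lra.
Qed.

End weak_limits.

(** * Independent sequences *)

Section independence.
Context {R : realType} {T : topologicalType}.

Definition sep_at (a b : R) (f : T -> R) (s : bool) : set T :=
  if s then [set x | b < f x] else [set x | f x < a].

(** Rosenthal's independence of the pairs [f n < a], [b < f n] along a subsequence, asked of finite
    patterns only. *)
Definition indep (f : nat -> T -> R) := exists a b (n : nat -> nat),
  [/\ a < b, {homo n : i j / (i < j)%N}
    & forall (s : nat -> bool) k, exists x,
        forall i, (i < k)%N -> sep_at a b (f (n i)) (s i) x].

Section tree.
Variables (f : nat -> T -> R) (a b : R) (P : set (set T)).
Variables (F : set_system nat).
Hypotheses (FF : ProperFilter F) (ooF : \oo `<=` F).
Hypothesis P_neq0 : forall W, P W -> W !=set0.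
Hypothesis P_split : forall W, P W ->
  \forall n \near F, forall s, P (W `&` sep_at a b (f n) s).

(** The binary tree below [W]: all [2^(size ns)] cells given by patterns along [ns] are still large
    in the sense of [P]. *)
Let Fixpoint full (ns : seq nat) (W : set T) : Prop :=
  if ns is n :: ns' then forall s, full ns' (W `&` sep_at a b (f n) s) else P W.

Let full_rcons ns W : full ns W -> \forall n \near F, full (rcons ns n) W.
Proof.
elim: ns W => [|m ns ih] W /=; first exact: P_split.
move=> h; apply: filterS2 (ih _ (h true)) (ih _ (h false)) => n ht hf.
by case.
Qed.

Let full_ex ns W (s : nat -> bool) : full ns W -> exists x, W x /\
  forall i, (i < size ns)%N -> sep_at a b (f (nth 0%N ns i)) (s i) x.
Proof.
elim: ns W s => [|m ns ih] W s /=; first by move=> /P_neq0[x]; exists x.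
move=> /(_ (s 0%N)) /(ih _ (s \o S))[x [[Wx x0] xS]].
by exists x; split=> // -[|i] //; exact: xS.
Qed.

(** A tree of finite depth has finitely many leaves, so a single index taken from [F] splits all of
    them. It can be taken beyond the earlier indices because [F] refines [\oo]. *)
Lemma indep_tree W : a < b -> P W -> indep f.
Proof.
move=> ab PW.
have /choice[g gP] : forall ns, exists n, full ns W ->
    full (rcons ns n) W /\ forall m, m \in ns -> (m < n)%N.
  move=> ns.
  have [nsW|] := pselect (full ns W); last by exists 0%N.
  have h : \forall n \near F, forall m, m \in ns -> (m < n)%N.
    apply: ooF; exists (\max_(m <- ns) m).+1 => // n /= lt m mns.
    by apply: leq_ltn_trans lt; apply: (@leq_bigmax_seq _ _ predT id).
  by have [n [? ?]] := filter_ex (filterI (full_rcons nsW) h); exists n.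
pose ns k := iter k (fun l => rcons l (g l)) [::].
have nsW k : full (ns k) W by elim: k => //= k /gP[].
have size_ns k : size (ns k) = k by elim: k => //= k; rewrite size_rcons => ->.
have ns_nth k i : (i < k)%N -> nth 0%N (ns k) i = g (ns i).
  elim: k => // k ih; rewrite ltnS leq_eqVlt /= nth_rcons size_ns.
  by move=> /orP[/eqP ->|ik]; [rewrite ltnn eqxx|rewrite ik ih].
exists a, b, (g \o ns); split=> // [i j ij|s k] /=.
  have [_] := gP _ (nsW j); apply.
  by rewrite -(ns_nth _ _ ij) mem_nth ?size_ns.
have [x [_ xP]] := full_ex s (nsW k); exists x => i ik.
by have := xP i; rewrite size_ns ns_nth//; apply.
Qed.

End tree.

Lemma ultra_oo : exists U : set_system nat, UltraFilter U /\ \oo `<=` U.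
Proof. by have [U [? ?]] := @ultraFilterLemma nat \oo _; exists U. Qed.

Lemma compact_ultra_cvg (X : topologicalType) I (U : set_system I) (x : I -> X) :
  UltraFilter U -> compact [set: X] -> exists l : X, x i @[i --> U] --> l.
Proof.
move=> UU cX; rewrite compact_ultra in cX.
have [|l [_ xl]] := cX (x i @[i --> U]) _ (filterT : U setT); last by exists l.
split=> [|G GG xG]; first exact: fmap_proper_filter.
apply/seteqP; split=> A; last exact: xG.
move=> GA; have [//|UnA] := in_ultra_setVsetC (x @^-1` A) UU.
have /xG GnA : (x i @[i --> U]) (~` A) by [].
by have := filter_ex (filterI GA GnA) => -[y []].
Qed.

Hypothesis cT : compact [set: T].

(** An ultrafilter limit of points realising longer and longer prefixes of a pattern realises all of
    it, strict inequalities becoming weak. *)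
Lemma indep_compact f : (forall n, continuous (f n)) -> indep f ->
  exists a b (n : nat -> nat),
  [/\ a < b, {homo n : i j / (i < j)%N}
    & forall s : nat -> bool, exists x,
        forall i, if s i then b <= f (n i) x else f (n i) x <= a].
Proof.
move=> cf [a [b [n [ab nh fs]]]]; exists a, b, n; split=> // s.
have [x xs] := choice (fs s).
have [U [UU ooU]] := ultra_oo.
have [l xl] := compact_ultra_cvg x UU cT.
exists l => i.
have fl : f (n i) (x k) @[k --> U] --> f (n i) l.
  by apply: continuous_cvg => //; exact: cf.
have lt : \forall k \near U, (i < k)%N by apply: ooU; exists i.+1.
case: ifPn => si.
  rewrite -(ulim_eq UU fl); apply: ulim_ge; first last.
    apply: filterS lt => k ik; have := xs k _ ik.
    by rewrite /sep_at si => /ltW.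
  by have [M fM] := cont_bnd cT (cf (n i)); exists M => k.
rewrite -(ulim_eq UU fl); apply: ulim_le; first last.
  apply: filterS lt => k ik; have := xs k _ ik.
  by rewrite /sep_at (negbTE si) => /ltW.
by have [M fM] := cont_bnd cT (cf (n i)); exists M => k.
Qed.

Lemma indep_subseq f (m : nat -> nat) : {homo m : i j / (i < j)%N} ->
  indep (f \o m) -> indep f.
Proof.
move=> mh [a [b [n [ab nh fs]]]]; exists a, b, (m \o n); split=> //.
by move=> i j ij /=; apply: mh; apply: nh.
Qed.

Lemma homo_ge n : {homo n : i j / (i < j)%N} -> forall k, (k <= n k)%N.
Proof.
by move=> nh; elim=> // k ih; apply: leq_ltn_trans ih (nh _ _ _).
Qed.

(** The alternating pattern would make the values at a single point oscillate by at least
    [b - a]. *)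
Lemma cvg_not_indep f : (forall n, continuous (f n)) ->
  (forall x, cvg (f n x @[n --> \oo])) -> ~ indep f.
Proof.
move=> cf fc /(indep_compact cf)[a [b [n [ab nh fs]]]].
have [x xP] := fs odd; have /cvg_ex[l fl] := fc x.
have e0 : 0 < (b - a) / 2 by lra.
have /cvgrPdist_lt/(_ _ e0)[N _ NP] := fl.
have h1 := NP _ (leq_trans (leq_trans (leq_addr _ _) (leq_addr _ _)) (homo_ge nh (N + N + 1))).
have h2 := NP _ (leq_trans (leq_addr _ _) (homo_ge nh (N + N))).
have := xP (N + N)%N; have := xP (N + N + 1)%N.
rewrite addnn addn1 oddS odd_double/= -addnn; rewrite addn1 in h1.
by move: h1 h2; rewrite /= !ltr_norml; lra.
Qed.

End independence.

(** * Consequences of the absence of independence *)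

Section stability.
Context {R : realType} {T : topologicalType}.
Hypothesis cT : compact [set: T].
Variables (Z : set T) (lam : (T -> R) -> R).
Hypothesis plam : posfun Z lam.

(** This is [wlim_gt0] for the functional with density [y] with respect to [lam]. *)
Lemma wlim_mul_gt0 I (U : set_system I) (u : I -> T -> R) (C : R) (y : T -> R) :
  UltraFilter U -> (forall i, continuous (u i)) ->
  (forall i z, `|u i z| <= C) ->
  continuous y -> (forall z, 0 <= y z) -> 0 < wlim lam U u y ->
  \forall k \near U, 0 < wlim lam U u (y * u k).
Proof.
move=> UU cu uC cy y0 Ly.
have py : posfun Z (fun h => lam (y * h)) by apply: posfunM.
have E h : wlim (fun h => lam (y * h)) U u h = wlim lam U u (y * h).
  by congr ulim; apply/funext => i; congr lam; ring.
have := wlim_gt0 cT py UU cu uC; rewrite E mulr1 => /(_ Ly).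
by apply: filterS => k; rewrite E.
Qed.

(** If every point of [Z] where [y] is positive had a nonnegative [lam]-null function positive
    there, compactness would bound [y] on [Z] by a null function plus a small constant. *)
Lemma support_point (y : T -> R) : closed Z -> continuous y -> 0 < lam y ->
  exists x, [/\ Z x, 0 < y x & forall y' : T -> R, continuous y' ->
    (forall z, 0 <= y' z) -> 0 < y' x -> 0 < lam y'].
Proof.
move=> clZ cy ly; apply: contrapT => /forallNP nx.
pose N := [set i : T -> R | [/\ continuous i, forall z, 0 <= i z & lam i <= 0]].
have l1 := pf1_ge0 plam.
pose eta := lam y / (2 * (lam 1 + 1)).
have eta0 : 0 < eta by rewrite divr_gt0//; lra.
pose A := Z `&` [set x | eta <= y x].
have cA : compact A.
  apply: (subclosed_compact _ cT) => //; apply: closedI => //.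
  by apply: (@closed_comp _ _ y [set r | eta <= r]) => // x _; exact: cy.
(* Null functions are directed upwards by sums, so their upper cones generate a filter;
   near-covering along it replaces the choice of a finite subcover. *)
pose F := filter_from N (fun i => [set i' | N i' /\ forall z, i z <= i' z]).
have N0 : N (cst 0).
  split=> //; first by cts.
  by rewrite (pf_cst plam) mul0r.
have FF : ProperFilter F.
  apply: filter_from_proper => [|i Ni]; last by exists i.
  apply: filter_from_filter; first by exists (cst 0).
  move=> i j [ci i0 li] [cj j0 lj]; exists (i + j).
    split; [by cts|by move=> z; rewrite addr_ge0|].
    by rewrite (pfD plam)//; lra.
  move=> k [Nk ijk]; split; split=> // z; apply: le_trans (ijk z);
    by rewrite funE ?lerDl ?lerDr.
have : \forall i \near F, A `<=` [set x | y x < i x].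
  move/compact_near_coveringP : cA; apply => x [Zx yx].
  have y0 : 0 < y x by exact: lt_le_trans yx.
  have [i [ci [i0 [ix li]]]] : exists i : T -> R, continuous i /\ (forall z, 0 <= i z) /\
      0 < i x /\ lam i <= 0.
    apply: contrapT => h; apply: (nx x); split=> // i ci i0 ix.
    by rewrite ltNge; apply/negP => li; apply: h; exists i.
  pose k := (y x + 1) / i x; have k0 : 0 < k by rewrite divr_gt0//; lra.
  have ck : continuous (k *: i - y) by cts.
  have Nki : N (k *: i).
    split; [by cts|by move=> z; rewrite funE mulr_ge0// ltW|].
    by rewrite (pfZ plam)// pmulr_rle0.
  have kx : 0 < (k *: i - y) x.
    by rewrite !funE /k divfK ?gt_eqF//; lra.
  have nk : \forall x' \near x, 0 < (k *: i - y) x'.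
    by apply: (cvgr_gt ((k *: i - y) x)) => //; exact: ck.
  exists ([set x' | 0 < (k *: i - y) x'],
    [set i' | N i' /\ forall z, (k *: i) z <= i' z]).
    by split=> //; exists (k *: i).
  move=> [x' i'] [/= h [_ ii']]; have := ii' x'; move: h; rewrite !funE; lra.
have FN : F N by exists (cst 0) => // i [].
move=> /(filterI FN)/filter_ex[i [[ci i0 li] Ai]].
have : lam y <= lam (i + cst eta).
  apply: (le_pf plam) => // [|z Zz]; first by cts.
  rewrite !funE /=; have [ez|ez] := leP eta (y z).
    by have := Ai z (conj Zz ez) => /=; lra.
  by have := i0 z; lra.
rewrite (pfD plam ci (@cont_cst R T eta)) (pf_cst plam eta).
have : eta * lam 1 <= lam y / 2.
  rewrite (_ : lam y / 2 = eta * (lam 1 + 1)); last by rewrite /eta; field; lra.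
  by rewrite ler_pM2l//; lra.
by lra.
Qed.

End stability.

(** * Sequences tending to zero pointwise *)

Section vanishing.
Context {R : realType} {T : topologicalType}.
Hypothesis cT : compact [set: T].
Variables (Z : set T) (lam : (T -> R) -> R).
Hypotheses (clZ : closed Z) (plam : posfun Z lam).

(** Otherwise the truncations [F n = (f n - b)^+] have a nonzero weak limit [L], and sets charged by
    [L] split both ways: above [b] because multiplication by [F n] keeps [L] positive, below [b / 2]
    by pointwise convergence at a support point. *)
Lemma ulim_pf_eq0 (f : nat -> T -> R) (C : R) (U : set_system nat) :
  UltraFilter U -> \oo `<=` U ->
  (forall n, continuous (f n)) -> (forall n x, 0 <= f n x <= C) ->
  ~ indep f -> (forall z, Z z -> f n z @[n --> U] --> 0) ->
  ulim U (lam \o f) = 0.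
Proof.
move=> UU ooU cf fC nif fz.
have fb n x : `|f n x| <= C.
  by have /andP[f0 ?] := fC n x; rewrite ger0_norm.
have bl : bnd (lam \o f).
  by exists (C * lam 1) => n; apply: (pf_bound plam) => // z _; exact: fb.
apply/eqP; rewrite eq_le; apply/andP; split; last first.
  apply: ulim_ge => //; apply: filterE => n; apply: (pf_ge0 plam) => // z _.
  by have /andP[] := fC n z.
rewrite leNgt; apply/negP => c0; apply: nif.
pose c := ulim U (lam \o f).
have l1 := pf1_ge0 plam.
(* Truncation at [b] costs at most [b * lam 1 <= c / 2], so half of the limit [c] survives. *)
pose b := c / (2 * (lam 1 + 1)).
have b0 : 0 < b by rewrite divr_gt0//; lra.
pose F n : T -> R := (f n - cst b) \max cst 0.
have cF n : continuous (F n) by rewrite /F; cts.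
have F0 n x : 0 <= F n x by rewrite /F /Order.max_fun le_max lexx orbT.
have FC n x : `|F n x| <= C.
  rewrite ger0_norm// /F /Order.max_fun ge_max !funE /=.
  by have := fC n x; lra.
pose L := wlim lam U F.
have pL : posfun Z L by apply: wlim_posfun => //; exact: FC.
have L1 : 0 < L 1.
  suff : c - b * lam 1 <= L 1.
    apply: lt_le_trans; rewrite subr_gt0.
    apply: (@le_lt_trans _ _ (c / 2)); last by rewrite -/c in c0; lra.
    rewrite (_ : c / 2 = b * (lam 1 + 1)); last by rewrite /b; field; lra.
    by rewrite ler_pM2l//; lra.
  rewrite lerBlDr -[X in _ <= _ + X](ulim_cst UU) -ulimD; first last.
  - by exists `|b * lam 1|.
  - by apply: (wlim_bnd cT plam cF FC); cts.
  apply: le_ulim => //.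
    have [M hM] := wlim_bnd cT plam cF FC (@cont1 R T).
    exists (M + `|b * lam 1|) => i; apply: le_trans (ler_normD _ _) _.
    by rewrite lerD2r.
  apply: filterE => n /=; rewrite mulr1 -(pf_cst plam) -(pfD plam) //; last by cts.
  apply: (le_pf plam); [by cts..|move=> z _].
  rewrite funE /F /Order.max_fun /=.
  by rewrite -lerBlDr le_max !funE lexx.
pose P (W : set T) := exists y : T -> R, [/\ continuous y, forall z, 0 <= y z,
  [set x | 0 < y x] `<=` W & 0 < L y].
apply: (@indep_tree _ _ f (b / 2) b P U _ ooU _ _ setT) => //.
- move=> W [y [cy y0 yW Ly]].
  by have [x [_ /yW Wx _]] := support_point cT pL clZ cy Ly; exists x.
- move=> W [y [cy y0 yW Ly]].
  have h1 := wlim_mul_gt0 cT plam UU cF FC cy y0 Ly.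
  have [x [Zx yx xP]] := support_point cT pL clZ cy Ly.
  (* Once [f n x < b / 2], the product of [y] with [(b / 2 - f n)^+] is positive at the support
     point [x], hence charged by [L]. *)
  have h2 : \forall n \near U, f n x < b / 2.
    have b2 : 0 < b / 2 by lra.
    by have /cvgr_lt := fz x Zx; apply.
  apply: filterS2 h1 h2 => n Ln fnx [].
    exists (y * F n); split=> //; first by cts.
      by move=> z; rewrite mulr_ge0.
    move=> x' /=; rewrite funE => yF.
    have y'0 : 0 < y x'.
      by rewrite lt_def y0 andbT; apply: contraTneq yF => ->; rewrite mul0r ltxx.
    split; first exact: yW.
    move: yF; rewrite pmulr_rgt0// /F /Order.max_fun lt_max !funE /= ltxx orbF.
    by rewrite /sep_at /=; lra.
  pose G : T -> R := (cst (b / 2) - f n) \max cst 0.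
  have G0 z : 0 <= G z by rewrite /G /Order.max_fun le_max lexx orbT.
  have cG : continuous G by rewrite /G; cts.
  exists (y * G); split=> //; first by cts.
  - by move=> z; rewrite mulr_ge0.
  - move=> x' /=; rewrite funE => yF.
    have y'0 : 0 < y x'.
      by rewrite lt_def y0 andbT; apply: contraTneq yF => ->; rewrite mul0r ltxx.
    split; first exact: yW.
    move: yF; rewrite pmulr_rgt0// /G /Order.max_fun lt_max !funE /= ltxx orbF.
    by rewrite /sep_at /=; lra.
  - apply: xP; [by cts|by move=> z; rewrite mulr_ge0|].
    rewrite funE mulr_gt0// /G /Order.max_fun lt_max !funE /=.
    by apply/orP; left; lra.
- by lra.
- by exists 1; split=> //; cts.
Qed.

End vanishing.

(** If [s] exceeds [t] by more than [4 eta], some level [a j] lies at least [eta] above [t] and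
    [2 eta] below [s]; its product is at least [eta^2], which the factor in front turns into [2 C].
    An L^1 distance is thus reduced to finitely many oscillation terms. *)
Lemma dist_le_grid (R : realType) (C eta : R) : 0 < eta -> exists J : nat,
  let a (j : nat) := j%:R * eta - C in
  forall s t : R, `|s| <= C -> `|t| <= C ->
  `|s - t| <= 4 * eta + 2 * C / eta ^+ 2 * \sum_(j < J)
    (Num.max (s - (a j + eta)) 0 * Num.max (a j - t) 0 +
     Num.max (t - (a j + eta)) 0 * Num.max (a j - s) 0).
Proof.
move=> eta0; exists (Num.truncn (2 * C / eta)).+4 => a s t sC tC.
wlog st : s t sC tC / t <= s.
  move=> h; have [|st] := leP t s; first exact: h.
  rewrite distrC; apply: le_trans (h t s tC sC (ltW st)) _.
  rewrite lerD2l le_eqVlt; apply/orP; left; apply/eqP; congr (_ * _).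
  by apply: eq_bigr => j _; rewrite addrC.
have C0 : 0 <= C by exact: le_trans sC.
rewrite ger0_norm ?subr_ge0//.
have K0 : 0 <= 2 * C / eta ^+ 2 by rewrite divr_ge0 ?sqr_ge0// mulr_ge0.
have T0 (j : nat) : 0 <= Num.max (s - (a j + eta)) 0 * Num.max (a j - t) 0 +
     Num.max (t - (a j + eta)) 0 * Num.max (a j - s) 0.
  by rewrite addr_ge0// mulr_ge0// le_max lexx orbT.
have [st4|st4] := leP (s - t) (4 * eta).
  by rewrite (le_trans st4)// lerDl mulr_ge0// sumr_ge0.
(* The shift by 2 puts [a k] between [t + eta] and [t + 2 * eta]. *)
pose k := (Num.truncn ((t + C) / eta)).+2.
have tC0 : 0 <= t + C by move: tC; rewrite ler_norml; lra.
have tCe : 0 <= (t + C) / eta by rewrite divr_ge0// ltW.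
have [k1 k2] : t + eta <= a k /\ a k <= t + 2 * eta.
  have /andP[h1 h2] := truncn_itv tCe.
  rewrite ler_pdivlMr// in h1; rewrite ltr_pdivrMr// in h2.
  rewrite /a /k; move: h1 h2; rewrite -!natr1.
  by split; lra.
have kJ : (k < (Num.truncn (2 * C / eta)).+4)%N.
  rewrite /k !ltnS ltnW// ltnS; apply: le_truncn.
  by rewrite ler_pM2r ?invr_gt0//; move: tC; rewrite ler_norml; lra.
rewrite (bigD1 (Ordinal kJ))//= mulrDr addrA.
apply: (@le_trans _ _ (2 * C / eta ^+ 2 * (eta * eta))); last first.
  rewrite -[leLHS]addr0 lerD//; last by rewrite mulr_ge0// sumr_ge0.
  rewrite -[leLHS]add0r lerD//; first by rewrite mulr_ge0// ltW.
  rewrite ler_wpM2l// -[leLHS]addr0 lerD//; last first.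
    by rewrite mulr_ge0// le_max lexx orbT.
  by apply: ler_pM; rewrite ?(ltW eta0)// le_max; apply/orP; left; lra.
rewrite -expr2 divfK; last by rewrite expf_neq0// gt_eqF.
by move: sC tC; rewrite !ler_norml; lra.
Qed.

(** * Total boundedness in L^1 *)

Section total_boundedness.
Context {R : realType} {T : topologicalType}.
Hypothesis cT : compact [set: T].
Variables (Z : set T) (lam : (T -> R) -> R).
Hypotheses (clZ : closed Z) (plam : posfun Z lam).

(** On nonnegative [y], the functional [L y = lim_i lim_j lam (y G_j F_i)] does not depend on the
    order of the limits. Taking [F], then [G], as the outer sequence shows that sets charged by [L]
    split both above [b] and below [a]. *)
Let indep_oscillation (g : nat -> T -> R) (C a b : R) (U : set_system nat)
  (F := fun n => (g n - cst b) \max cst 0)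
  (G := fun n => (cst a - g n) \max cst 0) :
  UltraFilter U -> \oo `<=` U -> (forall n, continuous (g n)) ->
  (forall n x, `|g n x| <= C) -> a < b ->
  0 < ulim U (fun n => wlim lam U G (F n)) -> indep g.
Proof.
move=> UU ooU cg gC ab L1.
have cF n : continuous (F n) by rewrite /F; cts.
have cG n : continuous (G n) by rewrite /G; cts.
have F0 n x : 0 <= F n x by rewrite /F /Order.max_fun le_max lexx orbT.
have G0 n x : 0 <= G n x by rewrite /G /Order.max_fun le_max lexx orbT.
pose D := C + `|a| + `|b|.
have FD n x : `|F n x| <= D.
  rewrite ger0_norm// /F /Order.max_fun ge_max !funE /=.
  have := gC n x; have := normr_ge0 a; have := normr_ge0 b; have := ler_norm (- b).
  by rewrite normrN /D ler_norml; lra.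
have GD n x : `|G n x| <= D.
  rewrite ger0_norm// /G /Order.max_fun ge_max !funE /=.
  have := gC n x; have := normr_ge0 b; have := normr_ge0 a; have := ler_norm a.
  by rewrite /D ler_norml; lra.
have pF : posfun Z (wlim lam U F) by apply: wlim_posfun => //; exact: FD.
have pG : posfun Z (wlim lam U G) by apply: wlim_posfun => //; exact: GD.
pose L := wlim (wlim lam U G) U F.
pose L' := wlim (wlim lam U F) U G.
have pL : posfun Z L by apply: (wlim_posfun cT pG UU cF FD).
have LL' (y : T -> R) : continuous y -> (forall z, 0 <= y z) -> L y = L' y.
  move=> cy y0.
  have py : posfun Z (fun h => lam (y * h)) by apply: posfunM.
  have := wlim_exchange cT py UU cF cG FD GD.
  rewrite /L /L' /wlim => E.
  transitivity (ulim U (fun i => ulim U (fun i0 => lam (y * (G i0 * F i))))).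
    congr ulim; apply/funext => i; congr ulim; apply/funext => j.
    by congr lam; ring.
  rewrite E; congr ulim; apply/funext => i; congr ulim; apply/funext => j.
  by congr lam; ring.
have L10 : 0 < L 1.
  apply: (lt_le_trans L1); rewrite /L /wlim le_eqVlt; apply/orP; left; apply/eqP.
  by congr ulim; apply/funext => i; rewrite mulr1.
pose P (W : set T) := exists y : T -> R, [/\ continuous y, forall z, 0 <= y z,
  [set x | 0 < y x] `<=` W & 0 < L y].
apply: (@indep_tree _ _ g a b P U _ ooU _ _ setT) => //.
- move=> W [y [cy y0 yW Ly]].
  by have [x [_ /yW Wx _]] := support_point cT pL clZ cy Ly; exists x.
- move=> W [y [cy y0 yW Ly]].
  have h1 := wlim_mul_gt0 cT pG UU cF FD cy y0 Ly.
  rewrite LL'// in Ly.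
  have h2 := wlim_mul_gt0 cT pF UU cG GD cy y0 Ly.
  apply: filterS2 h1 h2 => n Ln L'n [].
    exists (y * F n); split=> //; first by cts.
      by move=> z; rewrite mulr_ge0.
    move=> x' /=; rewrite funE => yF.
    have y'0 : 0 < y x'.
      by rewrite lt_def y0 andbT; apply: contraTneq yF => ->; rewrite mul0r ltxx.
    split; first exact: yW.
    move: yF; rewrite pmulr_rgt0// /F /Order.max_fun lt_max !funE /= ltxx orbF.
    by rewrite /sep_at /=; lra.
  exists (y * G n); split=> //; first by cts.
  - by move=> z; rewrite mulr_ge0.
  - move=> x' /=; rewrite funE => yF.
    have y'0 : 0 < y x'.
      by rewrite lt_def y0 andbT; apply: contraTneq yF => ->; rewrite mul0r ltxx.
    split; first exact: yW.
    move: yF; rewrite pmulr_rgt0// /G /Order.max_fun lt_max !funE /= ltxx orbF.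
    by rewrite /sep_at /=; lra.
  - by rewrite LL'//; [cts|move=> z; rewrite mulr_ge0].
- by exists 1; split=> //; cts.
Qed.

(** Without independence the iterated oscillation limits at all grid levels vanish, so two terms of
    the sequence are close in L^1(lam). *)
Let not_separated (g : nat -> T -> R) (C d : R) :
  (forall n, continuous (g n)) -> (forall n x, `|g n x| <= C) -> ~ indep g ->
  0 < d -> (forall i j, (i < j)%N -> d <= lam (fun x => `|g i x - g j x|)) -> False.
Proof.
move=> cg gC nig d0 gd.
have [U [UU ooU]] := ultra_oo.
have l1 := pf1_ge0 plam.
pose eta := d / (8 * (lam 1 + 1)).
have eta0 : 0 < eta by rewrite divr_gt0//; lra.
have [J grid] := dist_le_grid C eta0.
pose a (j : nat) := j%:R * eta - C.
pose F j n : T -> R := (g n - cst (a j + eta)) \max cst 0.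
pose G j n : T -> R := (cst (a j) - g n) \max cst 0.
have cF j n : continuous (F j n) by rewrite /F; cts.
have cG j n : continuous (G j n) by rewrite /G; cts.
pose K := 2 * C / eta ^+ 2.
pose e := d / (8 * (`|K| + 1) * (J%:R + 1)).
have e0 : 0 < e by rewrite divr_gt0// !mulr_gt0// ltr_wpDl.
have F0 j n x : 0 <= F j n x by rewrite /F /Order.max_fun le_max lexx orbT.
have G0 j n x : 0 <= G j n x by rewrite /G /Order.max_fun le_max lexx orbT.
pose D j := C + `|a j| + `|a j + eta|.
have FD j n x : `|F j n x| <= D j.
  rewrite ger0_norm// /F /Order.max_fun ge_max !funE /=.
  have := gC n x; have := normr_ge0 (a j); have := normr_ge0 (a j + eta).
  have := ler_norm (- (a j + eta)).
  by rewrite normrN /D ler_norml; lra.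
have GD j n x : `|G j n x| <= D j.
  rewrite ger0_norm// /G /Order.max_fun ge_max !funE /=.
  have := gC n x; have := normr_ge0 (a j + eta); have := normr_ge0 (a j).
  have := ler_norm (a j).
  by rewrite /D ler_norml; lra.
have b1 j : bnd (fun n => wlim lam U (G j) (F j n)).
  exists (D j * D j * lam 1) => n; apply: ulim_norm_le => m.
  by apply: (pf_bound plam) => [|x _]; [cts|rewrite normrM ler_pM].
have b2 j : bnd (fun n => wlim lam U (F j) (G j n)).
  exists (D j * D j * lam 1) => n; apply: ulim_norm_le => m.
  by apply: (pf_bound plam) => [|x _]; [cts|rewrite normrM ler_pM].
have E j := wlim_exchange cT plam UU (cF j) (cG j) (FD j) (GD j).
have small j : ulim U (fun n => wlim lam U (G j) (F j n)) < e.
  apply: le_lt_trans e0; rewrite leNgt; apply/negP => pos.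
  by apply: nig; apply: (indep_oscillation UU ooU cg gC _ pos); rewrite ltrDl.
(* First [n] is fixed through the outer limits, in both orders, then [m > n] through the inner
   ones. *)
have /filter_ex[n nP] : \forall n \near U, forall j : 'I_J,
    wlim lam U (G j) (F j n) < e /\ wlim lam U (F j) (G j n) < e.
  apply: filter_forall => j; have := small j.
  move=> /[dup] /(near_ulim_lt UU (b1 j)) h1.
  rewrite E => /(near_ulim_lt UU (b2 j)) h2.
  by apply: filterS2 h1 h2.
have hm : \forall m \near U, forall j : 'I_J,
    lam (G j m * F j n) < e /\ lam (F j m * G j n) < e.
  apply: filter_forall => j; have [h1 h2] := nP j.
  have {}h1 := near_ulim_lt UU (wlim_bnd cT plam (cG j) (GD j) (@cF j n)) h1.
  have {}h2 := near_ulim_lt UU (wlim_bnd cT plam (cF j) (FD j) (@cG j n)) h2.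
  by apply: filterS2 h1 h2.
have nm : \forall m \near U, (n < m)%N by apply: ooU; exists n.+1.
have [m [mP nm']] := filter_ex (filterI hm nm).
have := gd _ _ nm'; apply/negP; rewrite -ltNge.
pose S := \sum_(j < J) (F j n * G j m + F j m * G j n).
have cS : continuous S by rewrite /S; cts.
have SE : lam S = \sum_(j < J) (lam (F j n * G j m) + lam (F j m * G j n)).
  rewrite (pf_sum plam); last by move=> j; cts.
  by apply: eq_bigr => j _; rewrite (pfD plam)//; cts.
apply: (@le_lt_trans _ _ (lam (cst (4 * eta) + K *: S))).
  apply: (le_pf plam); [|by cts|].
    by apply: (@cont_norm _ _ (g n - g m)); cts.
  move=> x _; rewrite !funE /S.
  apply: le_trans (grid _ _ (gC n x) (gC m x)) _.
  rewrite le_eqVlt; apply/orP; left; apply/eqP; congr (_ + _ * _).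
  by rewrite fct_sumE; apply: eq_bigr => j _; rewrite !funE /F /G /Order.max_fun !funE.
rewrite (pfD plam (@cont_cst R T _) (contZ cS)) (pf_cst plam (4 * eta)) (pfZ plam K cS).
have S0 : 0 <= lam S <= (J%:R + 1) * (2 * e).
  rewrite SE; apply/andP; split.
    by apply: sumr_ge0 => j _; rewrite addr_ge0// (pf_ge0 plam)// => [|z _||z _];
      try cts; rewrite mulr_ge0.
  apply: (@le_trans _ _ (\sum_(j < J) 2 * e)).
    apply: ler_sum => j _; have [h1 h2] := mP j.
    by rewrite mulrC in h1; lra.
  rewrite sumr_const card_ord -[_ *+ _]mulr_natl ler_wpM2r//; lra.
have h1 : 4 * eta * lam 1 <= d / 2.
  rewrite (_ : d / 2 = 4 * eta * (lam 1 + 1)); last by rewrite /eta; field; lra.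
  by rewrite ler_pM2l; lra.
have h2 : K * lam S <= d / 4.
  have J0 : 0 < J%:R + 1 :> R by rewrite ltr_wpDl.
  apply: (@le_trans _ _ (`|K| * ((J%:R + 1) * (2 * e)))).
    apply: le_trans (ler_norm _) _; rewrite normrM ler_wpM2l//.
    by have /andP[S0' ?] := S0; rewrite ger0_norm.
  have -> : `|K| * ((J%:R + 1) * (2 * e)) = d / 4 * (`|K| / (`|K| + 1)).
    rewrite /e; field.
    by rewrite !gt_eqF// ltr_wpDl.
  rewrite ler_piMr//; first by lra.
  by rewrite ler_pdivrMr ?mul1r ?lerDl// ltr_wpDl.
lra.
Qed.

(** Otherwise indices can be chosen successively at distance at least [d] from all earlier ones. *)
Lemma orbit_totally_bounded (f : nat -> T -> R) (C d : R) :
  (forall n, continuous (f n)) -> (forall n x, `|f n x| <= C) -> ~ indep f ->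
  0 < d -> exists N, forall n, exists2 s, (s < N)%N & lam (fun x => `|f n x - f s x|) < d.
Proof.
move=> cf fC nif d0; apply: contrapT => /forallNP h.
have /choice[c cP] : forall N, exists n, forall s, (s < N)%N ->
    d <= lam (fun x => `|f n x - f s x|).
  move=> N; have /existsNP[n nP] := h N; exists n => s sN.
  by rewrite leNgt; apply/negP => lt; apply: nP; exists s.
pose m := fix m k := if k is k'.+1 then c (m k').+1 else c 0%N.
(* [m k.+1] is far from every index up to [m k]; being at distance 0 from itself, it is larger. *)
have mS k : (m k < m k.+1)%N.
  rewrite ltnNge; apply/negP => le.
  have := cP (m k).+1 (m k.+1); rewrite ltnS => /(_ le) /=.
  rewrite (_ : (fun x => _) = cst 0); last first.
    by apply/funext => x; rewrite subrr normr0.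
  by rewrite (pf_cst plam) mul0r leNgt d0.
have mh : {homo m : i j / (i < j)%N} by apply: homo_ltn mS => ? ? ?; exact: ltn_trans.
apply: (@not_separated (f \o m) C d) => //.
- by move=> n /=; exact: cf.
- by move=> n x /=.
- by move=> /(indep_subseq mh).
- move=> i [//|j] ij; rewrite /= -/m.
  have := cP (m j).+1 (m i); rewrite ltnS.
  have -> : (m i <= m j)%N.
    by move: ij; rewrite ltnS leq_eqVlt => /orP[/eqP ->//|/mh/ltnW].
  move=> /(_ isT); congr (_ <= lam _); apply/funext => x; exact: distrC.
Qed.

End total_boundedness.

(** * Cesaro means *)

Section cesaro.
Context {R : realType} {T : topologicalType}.
Implicit Types f : nat -> T -> R.

Definition cesaro_mean f m : T -> R := m.+1%:R^-1 *: \sum_(i < m.+1) f i.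

Lemma cesaroE f m x : cesaro_mean f m x = m.+1%:R^-1 * \sum_(i < m.+1) f i x.
Proof. by rewrite /cesaro_mean funZ fct_sumE. Qed.

Lemma cont_cesaro f m : (forall n, continuous (f n)) -> continuous (cesaro_mean f m).
Proof. by move=> cf; rewrite /cesaro_mean; cts. Qed.

Lemma mean_le m (c : R) (u : nat -> R) : (forall i, u i <= c) ->
  m.+1%:R^-1 * \sum_(i < m.+1) u i <= c.
Proof.
move=> uc; rewrite ler_pdivrMl// mulr_natl.
have -> : c *+ m.+1 = \sum_(i < m.+1) c by rewrite sumr_const card_ord.
by apply: ler_sum.
Qed.

Section bernoulli.
Variables (k : nat) (p : {ffun 'I_k -> bool} -> T) (a b : R).

(** The uniform measure on patterns, carried to [T] by [p]; under it the bits of a pattern are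
    independent and fair. *)
Definition bernoulli (h : T -> R) := #|{ffun 'I_k -> bool}|%:R^-1 * \sum_s h (p s).

Lemma bernoulli_posfun : posfun setT bernoulli.
Proof.
split=> [h g _ _|c h _|h _ h0]; rewrite /bernoulli.
- by rewrite -mulrDr -big_split.
- by rewrite [RHS]mulrCA; congr (_ * _); rewrite mulr_sumr.
- apply: mulr_ge0; first by rewrite invr_ge0.
  by apply: sumr_ge0 => s _; exact: h0.
Qed.

Let card0 : #|{ffun 'I_k -> bool}|%:R != 0 :> R.
Proof. by rewrite card_ffun card_bool card_ord pnatr_eq0 expn_eq0. Qed.

Lemma bernoulli1 : bernoulli 1 = 1.
Proof. by rewrite /bernoulli sumr_const mulVf. Qed.

Let flip (i : 'I_k) (s : {ffun 'I_k -> bool}) : {ffun 'I_k -> bool} :=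
  [ffun j => (j == i) (+) s j].

Let flipK i : involutive (flip i).
Proof. by move=> s; apply/ffunP => j; rewrite !ffunE addbA addbb. Qed.

(** Flipping bit [i] pairs the patterns; in each pair one has [s i != s j], and there the two
    functions differ by at least [b - a]. *)
Lemma bernoulli_dist (g : nat -> T -> R) (i j : 'I_k) : a < b -> i != j ->
  (forall (s : {ffun 'I_k -> bool}) (l : 'I_k), sep_at a b (g l) (s l) (p s)) ->
  (b - a) / 2 <= bernoulli (fun x => `|g i x - g j x|).
Proof.
move=> ab ij gp; rewrite /bernoulli [leRHS]mulrC ler_pdivlMr ?lt_def ?card0 ?ler0n//.
have far (s : {ffun 'I_k -> bool}) : s i != s j -> b - a <= `|g i (p s) - g j (p s)|.
  have := gp s i; have := gp s j; rewrite /sep_at.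
  by case: (s i); case: (s j) => //= h1 h2 _;
    [rewrite ger0_norm|rewrite distrC ger0_norm]; lra.
pose h (s : {ffun 'I_k -> bool}) := `|g i (p s) - g j (p s)|.
rewrite (_ : \sum_s _ = (\sum_s (h s + h (flip i s))) / 2); last first.
  rewrite big_split/= [X in _ + X](_ : _ = \sum_s h s); first by lra.
  by rewrite [RHS](reindex_inj (inv_inj (flipK i))).
rewrite mulrAC ler_pM2r//.
have -> : (b - a) * #|{ffun 'I_k -> bool}|%:R = \sum_(s : {ffun 'I_k -> bool}) (b - a).
  by rewrite sumr_const mulr_natr.
apply: ler_sum => s _.
have [sij|/far] := eqVneq (s i) (s j); last first.
  by move=> /le_trans; apply; rewrite /h lerDl.
apply: (@le_trans _ _ (h (flip i s))); last by rewrite /h lerDr.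
apply: far; rewrite !ffunE eqxx (eq_sym j) (negbTE ij) sij.
by case: (s j).
Qed.

End bernoulli.

Hypothesis cT : compact [set: T].

(* An independent sequence is not totally bounded in L^1 of a Bernoulli
   measure, whereas total boundedness passes to convex hulls. *)
Lemma cesaro_not_indep f C : (forall n, continuous (f n)) ->
  (forall n x, `|f n x| <= C) -> ~ indep f -> ~ indep (cesaro_mean f).
Proof.
move=> cf fC nif [a [b [n [ab nh As]]]].
pose s2f k (s : {ffun 'I_k -> bool}) i := if insub i is Some j then s j else false.
have /choice[q qP] : forall k, exists q : (nat -> bool) -> T,
    forall s i, (i < k)%N -> sep_at a b (cesaro_mean f (n i)) (s i) (q s).
  by move=> k; have [q qP] := choice (fun s => As s k); exists q.
pose p k (s : {ffun 'I_k -> bool}) : T := q k (s2f k s).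
have pP k (s : {ffun 'I_k -> bool}) (i : 'I_k) :
    sep_at a b (cesaro_mean f (n i)) (s i) (p k s).
  by have := qP k (s2f k s) i (ltn_ord i); rewrite {1}/s2f valK.
have [U [UU ooU]] := ultra_oo.
(* A limit of Bernoulli measures over longer and longer patterns keeps all the means [(b - a) / 2]
   apart. *)
pose lam h := ulim U (fun k => bernoulli (p k) h).
have b1 : bnd (fun k => bernoulli (p k) 1).
  by exists 1 => k; rewrite bernoulli1 normr1.
have [bl plam] := posfun_ulim cT UU (fun k => bernoulli_posfun (p k)) b1.
rewrite -/lam in plam.
have cA m : continuous (cesaro_mean f m) by exact: cont_cesaro.
have lam1 : lam 1 = 1.
  by rewrite /lam -[RHS](ulim_cst UU); congr ulim; apply/funext => k; rewrite bernoulli1.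
have far i j : (i < j)%N ->
    (b - a) / 2 <= lam (fun x => `|cesaro_mean f (n i) x - cesaro_mean f (n j) x|).
  move=> ij; apply: ulim_ge.
    by apply: bl; apply: (@cont_norm _ _ (cesaro_mean f (n i) - cesaro_mean f (n j))); cts.
  have : \forall k \near U, (j < k)%N by apply: ooU; exists j.+1.
  apply: filterS => k jk.
  apply: (@bernoulli_dist k (p k) a b (cesaro_mean f \o n)
    (Ordinal (ltn_trans ij jk)) (Ordinal jk)) => //.
    by rewrite -val_eqE/= ltn_eqF.
  by move=> s l; exact: pP.
(* The closing estimate adds up to [4 * d = (b - a) / 4], below the separation. *)
pose d := (b - a) / 16; have d0 : 0 < d by rewrite /d; lra.
have [N fN] := orbit_totally_bounded cT closedT plam cf fC nif d0.
have /choice[c cP] : forall i, exists c : 'I_N, lam (fun x => `|f i x - f c x|) < d.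
  by move=> i; have [s sN sd] := fN i; exists (Ordinal sN).
(* The frequency of class [s] among the first [m.+1] terms: up to [d] in L^1, each mean is the
   combination of the [N] representatives with these weights. *)
pose w m (s : 'I_N) : R := m.+1%:R^-1 * \sum_(i < m.+1) (c i == s)%:R.
have w01 m s : `|w m s| <= 1.
  rewrite ger0_norm; last by rewrite mulr_ge0 ?invr_ge0// sumr_ge0.
  by apply: (@mean_le m 1 (fun i => (c i == s)%:R)) => i; case: eqP.
have wf m x : m.+1%:R^-1 * \sum_(i < m.+1) f (c i) x = \sum_s w m s * f s x.
  under [RHS]eq_bigr do rewrite /w -mulrA.
  rewrite -[RHS]mulr_sumr; congr (_ * _).
  under [RHS]eq_bigr do rewrite mulr_suml.
  rewrite exchange_big/=; apply: eq_bigr => i _.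
  rewrite (bigD1 (c i))//= eqxx mul1r big1 ?addr0// => s.
  by rewrite eq_sym => /negbTE ->; rewrite mul0r.
pose e := d / (2 * (N%:R + 1) * (`|C| + 1)).
have e0 : 0 < e by rewrite divr_gt0// !mulr_gt0// ltr_wpDl.
(* The weights are bounded, so they converge along [U]; two late means then have nearly equal
   weights. *)
have hw : \forall i \near U, forall s, `|ulim U (fun i => w (n i) s) - w (n i) s| < e.
  apply: filter_forall => s; apply: (near_ulim UU (a := fun i => w (n i) s)) => //.
  by exists 1 => i.
have [i hi] := filter_ex hw.
have ij : \forall j \near U, (i < j)%N by apply: ooU; exists i.+1.
have [j [hj {}ij]] := filter_ex (filterI hw ij).
have := far _ _ ij; apply/negP; rewrite -ltNge.
pose r m : T -> R := cesaro_mean (fun i x => `|f i x - f (c i) x|) m.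
have cr0 (l : nat) : continuous (fun x => `|f l x - f (c l) x|).
  by apply: (@cont_norm _ _ (f l - f (c l))); cts.
have cr m : continuous (r m) by exact: cont_cesaro.
have rd m : lam (r m) <= d.
  rewrite /r /cesaro_mean (pfZ plam); last by apply: cont_sum => l; exact: cr0.
  rewrite (pf_sum plam); last by move=> l; exact: cr0.
  by apply: (@mean_le m d (fun i => lam (fun x => `|f i x - f (c i) x|))) => l; exact/ltW.
have close m x : `|cesaro_mean f m x - \sum_s w m s * f s x| <= r m x.
  rewrite -wf /r !cesaroE -mulrBr -sumrB normrM ger0_norm ?invr_ge0//.
  by rewrite ler_wpM2l ?invr_ge0// ler_norm_sum.
apply: (@le_lt_trans _ _ (lam (r (n i) + r (n j) + cst (2 * d)))).
  apply: (le_pf plam); [|by cts|move=> x _].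
    by apply: (@cont_norm _ _ (cesaro_mean f (n i) - cesaro_mean f (n j))); cts.
  have h1 := close (n i) x; have h2 := close (n j) x.
  have h3 : `|\sum_s w (n i) s * f s x - \sum_s w (n j) s * f s x| <= 2 * d.
    rewrite -sumrB; apply: le_trans (ler_norm_sum _ _ _) _.
    apply: (@le_trans _ _ (\sum_(s < N) (2 * e * `|C|))).
      apply: ler_sum => s _; rewrite -mulrBl normrM ler_pM//.
        by move: (hi s) (hj s); rewrite ler_norml !ltr_norml; lra.
      by apply: le_trans (fC _ _) _; exact: ler_norm.
    rewrite sumr_const card_ord -[_ *+ _]mulr_natl.
    have -> : N%:R * (2 * e * `|C|) = d * ((N%:R / (N%:R + 1)) * (`|C| / (`|C| + 1))).
      by rewrite /e; field; rewrite !gt_eqF// ltr_wpDl.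
    apply: (@le_trans _ _ (d * 1)); last by rewrite mulr1; lra.
    have frac (z : R) : 0 <= z -> 0 <= z / (z + 1) <= 1.
      move=> z0; have z1 : 0 < z + 1 by lra.
      by rewrite divr_ge0 ?(ltW z1)//= ler_pdivrMr// mul1r lerDl.
    have /andP[N0 N1] := frac N%:R (ler0n _ _).
    have /andP[C0 C1] := frac `|C| (normr_ge0 _).
    by apply: ler_wpM2l; [exact: ltW|exact: mulr_ile1].
  rewrite !funE /=; move: h1 h2 h3; rewrite !ler_norml; lra.
have crr : continuous (r (n i) + r (n j)) by cts.
rewrite (pfD plam crr (@cont_cst R T _)) (pf_cst plam (2 * d)) lam1 mulr1.
rewrite (pfD plam (cr _) (cr _)).
have := rd (n i); have := rd (n j); rewrite /d; lra.
Qed.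

End cesaro.

(** * Minimal sets *)

Section minimal_sets.

(** Zorn's lemma for reverse inclusion: compactness keeps the intersection of a chain nonempty. A
    general [P] serves both minimal invariant sets and minimal subsemigroups. *)
Lemma closed_zorn (X : topologicalType) (P : set X -> Prop) (A0 : set X) :
  compact [set: X] -> (forall A, P A -> closed A /\ A !=set0) ->
  (forall F : set (set X), F !=set0 -> F `<=` P ->
     \bigcap_(A in F) A !=set0 -> P (\bigcap_(A in F) A)) ->
  P A0 -> exists A, [/\ P A, A `<=` A0 & forall B, P B -> B `<=` A -> A `<=` B].
Proof.
move=> cX Pc Pcap PA0; pose S := {A : set X | P A /\ A `<=` A0}.
pose R (A B : S) := `[< sval B `<=` sval A >].
pose t0 : S := exist _ A0 (conj PA0 (@subset_refl _ A0)).
have [|A B C /asboolP AB /asboolP BC|F totF|[A [PA AA0]] Amax] := ZL_preorder t0 (R := R).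
- by move=> A; apply/asboolP.
- by apply/asboolP => x /BC /AB.
- have [[A1 FA1]|F0] := pselect (F !=set0); last first.
    by exists t0 => A FA; exfalso; apply: F0; exists A.
  pose G := [set sval A | A in F].
  have GP : G `<=` P by move=> _ [[A [PA ?]] _ <-].
  have GA1 : G (sval A1) by exists A1.
  have FG : ProperFilter (filter_from G id).
    apply: filter_from_proper; last by move=> A /GP /Pc [].
    apply: filter_from_filter; first by exists (sval A1).
    move=> _ _ [A FA <-] [B FB <-].
    have [/asboolP AB|/asboolP BA] := totF _ _ FA FB.
      by exists (sval B); [exists B|move=> x Bx; split=> //; exact: AB].
    by exists (sval A); [exists A|move=> x Bx; split=> //; exact: BA].
  have [p [_ clp]] := cX _ FG (filterT : filter_from G id setT).
  have capG : \bigcap_(A in G) A !=set0.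
    exists p => A GA; have [clA _] := Pc _ (GP _ GA).
    by apply: clA => B Bp; apply: clp Bp; exists A.
  have PG : P (\bigcap_(A in G) A) by apply: Pcap => //; exists (sval A1).
  have GA0 : \bigcap_(A in G) A `<=` A0.
    by move=> x /(_ _ GA1); case: (A1) => [A [PA AA0]] /= /AA0.
  exists (exist _ (\bigcap_(A in G) A) (conj PG GA0)) => A FA.
  by apply/asboolP => /= x; apply; exists A.
- exists A; split=> // B PB BA.
  pose tB : S := exist _ B (conj PB (subset_trans BA AA0)).
  have AB : R (exist _ A (conj PA AA0)) tB by apply/asboolP.
  by have /asboolP := Amax _ AB.
Qed.

Definition invariant_set {X : Type} (phi : X -> X) (M : set X) :=
  forall x, M x -> M (phi x).

Definition minimal_set {X : topologicalType} (phi : X -> X) (M : set X) :=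
  [/\ closed M, M !=set0, invariant_set phi M & forall N : set X, closed N ->
    N !=set0 -> invariant_set phi N -> N `<=` M -> M `<=` N].

Lemma minimal_set_ex (X : topologicalType) (phi : X -> X) (A : set X) :
  compact [set: X] -> closed A -> A !=set0 -> invariant_set phi A ->
  exists2 M, minimal_set phi M & M `<=` A.
Proof.
move=> cX clA A0 iA.
pose P (M : set X) := [/\ closed M, M !=set0 & invariant_set phi M].
have [|F F0 FP capF|//|M [[clM M0 iM] MA Mmin]] := @closed_zorn X P A cX.
- by move=> B [].
- split=> //; first by apply: closed_bigI => B /FP[].
  by move=> x Fx B FB; have [_ _] := FP _ FB; apply; exact: Fx.
- by exists M => //; split=> // N clN N0 iN; apply: Mmin.
Qed.

Lemma invariant_iter (X : Type) (phi : X -> X) (M : set X) n x :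
  invariant_set phi M -> M x -> M (iter n phi x).
Proof. by move=> iM Mx; elim: n => // n; exact: iM. Qed.

End minimal_sets.

(** * Invariant states on minimal sets *)

Section unique_state.
Context {R : realType} {T : topologicalType}.
Hypothesis cT : compact [set: T].
Variable phi : T -> T.
Hypothesis cphi : continuous phi.

Lemma cont_iter n : continuous (iter n phi).
Proof.
by elim: n => [|n ih] x //=; apply: (@continuous_comp _ _ _ (iter n phi) phi);
  [exact: ih|exact: cphi].
Qed.

Definition orb (x : T -> R) n : T -> R := x \o iter n phi.

Lemma cont_orb x n : continuous x -> continuous (orb x n).
Proof.
by move=> cx w; apply: continuous_comp; [exact: cont_iter|exact: cx].
Qed.

(** An invariant probability measure, seen as a functional. *)
Definition invariant_state (Z : set T) (mu : (T -> R) -> R) :=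
  [/\ posfun Z mu, mu 1 = 1
    & forall x, continuous x -> mu (x \o phi) = mu x].

Implicit Types (x : T -> R) (M W Z : set T) (mu nu : (T -> R) -> R).

Lemma state_orb Z mu x n : invariant_state Z mu -> continuous x ->
  mu (orb x n) = mu x.
Proof.
move=> [_ _ imu] cx; elim: n => [|n ih]; first by congr mu.
rewrite -ih -[RHS]imu; last exact: cont_orb.
by congr mu; apply/funext => w; rewrite /orb /= -iterSr.
Qed.

Lemma state_cesaro Z mu x n : invariant_state Z mu -> continuous x ->
  mu (cesaro_mean (orb x) n) = mu x.
Proof.
move=> smu cx; have [pmu _ _] := smu; have cox m : continuous (orb x m) by exact: cont_orb.
rewrite /cesaro_mean (pfZ pmu); last by cts.
rewrite (pf_sum pmu); last by move=> i; exact: cox.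
under eq_bigr do rewrite (state_orb _ smu cx).
by rewrite sumr_const card_ord -[X in _ * X]mulr_natl mulrA mulVf ?mul1r.
Qed.

(** Each single step telescopes, leaving two boundary terms. *)
Lemma cesaro_shift x C m w j : (forall w, `|x w| <= C) ->
  `|cesaro_mean (orb x) m (iter j phi w) - cesaro_mean (orb x) m w| <= 2 * C * j%:R / m.+1%:R.
Proof.
move=> xC; elim: j => [|j ih]; first by rewrite subrr normr0 mulr0 mul0r.
set v := iter j phi w in ih *; set c := cesaro_mean _ _.
have h : `|c (phi v) - c v| <= 2 * C / m.+1%:R.
  rewrite /c !cesaroE -mulrBr normrM ger0_norm ?invr_ge0// mulrC ler_wpM2r ?invr_ge0//.
  have -> : \sum_(i < m.+1) orb x i (phi v) - \sum_(i < m.+1) orb x i v =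
      orb x m.+1 v - orb x 0 v.
    rewrite big_ord_recr [X in _ - X]big_ord_recl/=.
    rewrite (eq_bigr (fun i : 'I_m => orb x i.+1 v)); last first.
      by move=> i _; rewrite /orb /= -iterSr.
    rewrite [X in _ - (_ + X)](eq_bigr (fun i : 'I_m => orb x i.+1 v))//.
    by rewrite /orb /= -iterSr; lra.
  apply: le_trans (ler_normB _ _) _.
  by rewrite mulr_natl mulr2n lerD// xC.
rewrite -[iter j.+1 phi w]/(phi v) -(@natr1 R j) mulrDr mulr1 mulrDl.
have -> : c (phi v) - c w = (c v - c w) + (c (phi v) - c v) by lra.
by apply: le_trans (ler_normD _ _) _; rewrite lerD.
Qed.

(** The points of [M] never visiting [W] form a closed invariant set, empty by minimality;
    compactness then bounds the waiting time. *)
Lemma minimal_visits M (W : set T) : minimal_set phi M -> open W ->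
  W `&` M !=set0 -> exists k, forall w, M w -> exists2 j, (j <= k)%N & W (iter j phi w).
Proof.
move=> [clM _ iM minM] oW [w0 [Ww0 Mw0]].
have cM : compact M by apply: (subclosed_compact _ cT).
have hit w : M w -> exists j, W (iter j phi w).
  move=> Mw; apply: contrapT => /forallNP nW.
  pose N := M `&` [set w | forall j, ~ W (iter j phi w)].
  suff /(_ _ Mw0)[_ /(_ 0%N)] : M `<=` N by [].
  apply: minM => //; first last.
  - by move=> v [].
  - move=> v [Mv nv]; split; first exact: iM.
    by move=> j; rewrite -iterSr; exact: nv.
  - by exists w.
  apply: closedI => //; rewrite (_ : [set _ | _] =
      \bigcap_(j in setT) (iter j phi @^-1` ~` W)); last first.
    by apply/seteqP; split=> v /=; [move=> h j _; exact: h|move=> h j; exact: h].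
  apply: closed_bigI => j _; apply: closed_comp; last exact: open_closedC.
  by move=> v _; exact: cont_iter.
have /filter_ex[k kP] : \forall k \near \oo,
    M `<=` [set w | exists2 j, (j <= k)%N & W (iter j phi w)].
  move/compact_near_coveringP : cM; apply => w Mw.
  have [j Wj] := hit w Mw.
  exists (iter j phi @^-1` W, [set k | (j <= k)%N]).
    split; last by exists j.
    by apply: cont_iter; apply: open_nbhs_nbhs.
  by move=> [v k] [/= Wv jk]; exists j.
by exists k.
Qed.

(* If the averages over a minimal set had two different limits, both values
   would be approached near every point of the set by the same Cesaro mean,
   making the means independent. *)
Lemma state_minimal_le M mu nu x : minimal_set phi M -> invariant_state M mu ->
  invariant_state M nu -> continuous x -> ~ indep (orb x) -> nu x <= mu x.
Proof.
move=> minM smu snu cx nix; rewrite leNgt; apply/negP => lt.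
have [C xC] := cont_bnd cT cx.
have cox n : continuous (orb x n) by exact: cont_orb.
have oxC n w : `|orb x n w| <= C by exact: xC.
apply: (cesaro_not_indep cT cox oxC nix).
pose d := (nu x - mu x) / 4; have d0 : 0 < d by rewrite /d; lra.
pose P (W : set T) := open W /\ W `&` M !=set0.
apply: (@indep_tree _ _ _ (mu x + d) (nu x - d) P \oo _ _ _ _ setT) => //.
- by move=> W [_ [w [Ww _]]]; exists w.
- move=> W [oW WM]; have [k kP] := minimal_visits minM oW WM.
  (* Beyond this threshold a shift by at most [k] steps changes the Cesaro mean by at most
     [d / 2]. *)
  pose D := 2 * C * k%:R / (d / 2).
  exists (Num.bound `|D|) => // n /= Dn s.
  have cA : continuous (cesaro_mean (orb x) n) by exact: cont_cesaro.
  have small j w : (j <= k)%N ->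
      `|cesaro_mean (orb x) n (iter j phi w) - cesaro_mean (orb x) n w| <= d / 2.
    move=> jk; apply: le_trans (cesaro_shift _ _ _ xC) _.
    have C0 : 0 <= C by exact: le_trans (xC w).
    have Dn' : D <= n.+1%:R.
      apply: le_trans (_ : (Num.bound `|D|)%:R <= _); last by rewrite ler_nat ltnW.
      by apply: le_trans (ler_norm _) _; apply/ltW/archi_boundP.
    rewrite ler_pdivrMr// [leRHS]mulrC -ler_pdivrMr; last by lra.
    apply: le_trans Dn'; rewrite /D ler_pM2r ?invr_gt0; last by lra.
    by rewrite ler_wpM2l ?mulr_ge0 ?ler_nat.
  have oS : open (sep_at (mu x + d) (nu x - d) (cesaro_mean (orb x) n) s).
    by case: s; [apply: (@open_comp _ _ _ [set r | _ < r])|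
      apply: (@open_comp _ _ _ [set r | r < _])] => // w _; exact: cA.
  split; first exact: openI.
  case: s oS => _.
    have [pnu nu1 _] := snu.
    (* The mean has [nu]-average [nu x], so it exceeds [nu x - d / 2] somewhere on [M]; at most [k]
       steps later the orbit is in [W], at a cost of [d / 2]. *)
    have [w [Mw lw]] : exists w, M w /\ nu x - d / 2 < cesaro_mean (orb x) n w.
      apply: contrapT => /forallNP h.
      have : nu (cesaro_mean (orb x) n) <= nu (cst (nu x - d / 2)).
        apply: (le_pf pnu) => //; first exact: cont_cst.
        by move=> w Mw; rewrite leNgt; apply/negP => ?; apply: (h w).
      by rewrite (state_cesaro _ snu cx) (pf_cst pnu) nu1; lra.
    have [j jk Wj] := kP _ Mw; exists (iter j phi w); split; last first.
      by case: minM => _ _ iM _; exact: invariant_iter.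
    by split=> //; rewrite /sep_at/=; have := small j w jk; rewrite ler_norml; lra.
  have [pmu mu1 _] := smu.
  have [w [Mw lw]] : exists w, M w /\ cesaro_mean (orb x) n w < mu x + d / 2.
    apply: contrapT => /forallNP h.
    have : mu (cst (mu x + d / 2)) <= mu (cesaro_mean (orb x) n).
      apply: (le_pf pmu) => //; first exact: cont_cst.
      by move=> w Mw; rewrite leNgt; apply/negP => ?; apply: (h w).
    by rewrite (state_cesaro _ smu cx) (pf_cst pmu) mu1; lra.
  have [j jk Wj] := kP _ Mw; exists (iter j phi w); split; last first.
    by case: minM => _ _ iM _; exact: invariant_iter.
  by split=> //; rewrite /sep_at/=; have := small j w jk; rewrite ler_norml; lra.
- by rewrite /d; lra.
- split; first exact: openT.
  by case: minM => _ [w Mw] _ _; exists w.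
Qed.

End unique_state.

(** * The enveloping semigroup *)

Section enveloping.
Context {R : realType} {Omega : metricType R}.
Hypothesis cO : compact [set: Omega].
Variable phi : Omega -> Omega.
Hypothesis cphi : continuous phi.
Local Notation W := {ptws Omega -> Omega}.

Let itw (n : nat) : W := iter n phi.

(** Cluster points at infinity, not the closure of all iterates: each element is then a limit along
    an ultrafilter refining [\oo], as [ulim_pf_eq0] requires. *)
Definition limit_semigroup : set W := cluster (itw n @[n --> \oo]).
Local Notation E := limit_semigroup.

Lemma cvg_ptws I (G : set_system I) {FG : Filter G} (p : I -> W) (q : W) :
  (forall w, p i w @[i --> G] --> q w) -> p i @[i --> G] --> q.
Proof. by move=> pq; apply/pointwise_cvgP. Qed.

Lemma ptws_eval_cvg I (G : set_system I) (p : I -> W) (q : W) w :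
  p i @[i --> G] --> q -> p i w @[i --> G] --> q w.
Proof.
move=> pq; apply: (cvg_comp p (fun r : W => r w) pq).
exact: (@proj_continuous Omega (fun=> Omega) w).
Qed.

Lemma compact_ptws : compact [set: W].
Proof.
have := @tychonoff Omega (fun=> Omega) (fun=> setT) (fun=> cO).
by congr compact; apply/seteqP; split.
Qed.

Lemma hausdorff_ptws : hausdorff_space W.
Proof. by apply: hausdorff_product => _; exact: metric_hausdorff. Qed.

Lemma ptws_eval_continuous (w : Omega) : continuous (fun p : W => p w).
Proof. exact: (@proj_continuous Omega (fun=> Omega) w). Qed.

Lemma ptws_compl_continuous : continuous (fun p : W => phi \o p : W).
Proof.
move=> p; apply: (@cvg_ptws _ _ (nbhs_filter p)) => w /=.
by apply: continuous_cvg; [exact: cphi|exact: ptws_eval_continuous].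
Qed.

Lemma ptws_compr_continuous (q : W) : continuous (fun p : W => p \o q : W).
Proof.
by move=> p; apply: (@cvg_ptws _ _ (nbhs_filter p)) => w /=; exact: ptws_eval_continuous.
Qed.

Lemma limit_semigroupP p : E p <->
  forall (B : set W) N, nbhs p B -> exists2 n, (N <= n)%N & B (itw n).
Proof.
split=> [Ep B N pB|h A B [N _ NA] pB]; last first.
  have [n Nn Bn] := h B N pB; exists (itw n); split=> //; exact: NA.
have [|_ [[n Nn <-] Bn]] := Ep [set itw n | n in [set n | (N <= n)%N]] B _ pB.
  by exists N => // n Nn /=; exists n.
by exists n.
Qed.

Lemma limit_semigroup_ultra p : E p -> exists U : set_system nat,
  [/\ UltraFilter U, \oo `<=` U & forall w, iter n phi w @[n --> U] --> p w].
Proof.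
move=> /limit_semigroupP Ep.
pose F := filter_from (fun BN : set W * nat => nbhs p BN.1)
  (fun BN => [set n | (BN.2 <= n)%N /\ BN.1 (itw n)]).
have FF : ProperFilter F.
  apply: filter_from_proper => [|[B N] /= pB]; last first.
    by have [n ? ?] := Ep B N pB; exists n.
  apply: filter_from_filter; first by exists (setT, 0%N); exact: filterT.
  move=> [B M] [C N] /= pB pC; exists (B `&` C, maxn M N); first exact: filterI.
  by move=> n [] /=; rewrite geq_max => /andP[? ?] [? ?].
have [U [UU FU]] := ultraFilterLemma FF.
exists U; split=> //.
  move=> A [N _ NA]; apply: FU; exists (setT, N); first exact: filterT.
  by move=> n [/= Nn _]; exact: NA.
suff : (itw n @[n --> U]) --> p by move=> Up w; exact: (ptws_eval_cvg Up).
move=> B pB; apply: FU; exists (B, 0%N) => //.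
by move=> n [].
Qed.

Lemma ultra_limit_semigroup (U : set_system nat) (p : W) : UltraFilter U ->
  \oo `<=` U -> (forall w, iter n phi w @[n --> U] --> p w) -> E p.
Proof.
move=> UU ooU Up; apply/limit_semigroupP => B N pB.
have h1 : \forall n \near U, B (itw n).
  have : (itw n @[n --> U]) --> p by exact: cvg_ptws.
  by apply.
have h2 : \forall n \near U, (N <= n)%N by apply: ooU; exists N.
by have [n [? ?]] := filter_ex (filterI h1 h2); exists n.
Qed.

Lemma limit_semigroup_neq0 : E !=set0.
Proof.
have [U [UU ooU]] := ultra_oo.
have [p Up] := compact_ultra_cvg itw UU compact_ptws.
by exists p; apply: (ultra_limit_semigroup UU ooU) => w; exact: (ptws_eval_cvg Up).
Qed.

Lemma closed_limit_semigroup : closed E.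
Proof. by rewrite /E clusterE; apply: closed_bigI => A _; exact: closed_closure. Qed.

Lemma limit_semigroup_compl p : E p -> E (phi \o p).
Proof.
move=> /limit_semigroupP Ep; apply/limit_semigroupP => B N.
move=> /ptws_compl_continuous pB; have [n Nn Bn] := Ep _ N pB.
by exists n.+1 => //; exact: leqW.
Qed.

(** Composition is continuous in its left argument, and in the right one when the left is an iterate
    of [phi]; so [p] is approximated first, then [q]. *)
Lemma limit_semigroup_comp p q : E p -> E q -> E (p \o q).
Proof.
move=> /limit_semigroupP Ep /limit_semigroupP Eq; apply/limit_semigroupP => B N.
move=> /nbhs_interior/ptws_compr_continuous pB.
have [n Nn Bn] := Ep _ N pB.
have iter_cont m : continuous (fun r : W => itw m \o r : W).
  move=> r; apply: (@cvg_ptws _ _ (nbhs_filter r)) => w /=.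
  by apply: continuous_cvg; [exact: cont_iter|exact: ptws_eval_continuous].
have /iter_cont qB : nbhs (itw n \o q : W) B by exact: Bn.
have [m _ Bm] := Eq _ 0%N qB.
exists (n + m)%N; first by rewrite (leq_trans Nn)// leq_addr.
by move: Bm; rewrite /= /itw; congr B; apply/funext => w /=; rewrite iterD.
Qed.

Lemma limit_semigroup_closed p (K : set Omega) w : closed K ->
  invariant_set phi K -> E p -> K w -> K (p w).
Proof.
move=> clK iK /limit_semigroup_ultra[U [UU _ Up]] Kw.
by apply: (closed_cvg _ clK _ _ (Up w)); apply: filterE => n; exact: invariant_iter.
Qed.

Lemma proximalP w1 w2 : inf (range (fun n =>
    mdist (iter n phi w1) (iter n phi w2))) = 0 <->
  forall e, 0 < e -> exists n, mdist (iter n phi w1) (iter n phi w2) < e.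
Proof.
set S := range _.
have hS : has_inf S.
  by split; [exists (mdist w1 w2), 0%N|exists 0 => _ [n _ <-]; exact: mdist_ge0].
split=> [S0 e e0|h].
  by have [_ [n _ <-]] := inf_adherent e0 hS; rewrite S0 add0r; exists n.
apply/eqP; rewrite eq_le; apply/andP; split.
  apply/ler_addgt0Pl => e e0; rewrite addr0; have [n ne] := h e e0.
  by apply: le_trans (ltW ne); apply: ge_inf; [case: hS|exists n].
by apply: lb_le_inf => [|_ [n _ <-]]; [case: hS|exact: mdist_ge0].
Qed.

Definition orbit_closure w := closure (range (fun n => iter n phi w)).

Lemma orbit_closure_self w : orbit_closure w w.
Proof. by apply: subset_closure; exists 0%N. Qed.

Lemma closed_orbit_closure w : closed (orbit_closure w).
Proof. exact: closed_closure. Qed.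

Lemma orbit_closure_invariant w : invariant_set phi (orbit_closure w).
Proof.
move=> z clz B /cphi zB; have [_ [[n _ <-] Bn]] := clz _ zB.
by exists (iter n.+1 phi w); split=> //; exists n.+1.
Qed.

(** The orbit of [y] approaches [q y] in [M]; as [y] lies in the orbit closure of [w], so does the
    orbit of [w], at arbitrarily late times. A limit [p] along these times has [p w = q y]. *)
Lemma minimal_visited w M : minimal_set phi M -> M `<=` orbit_closure w ->
  exists2 p, E p & M (p w).
Proof.
move=> [clM [y My] iM _] MO.
have [U [UU ooU]] := ultra_oo.
have [q Uq] := compact_ultra_cvg itw UU compact_ptws.
have Eq : E q by apply: (ultra_limit_semigroup UU ooU) => w'; exact: (ptws_eval_cvg Uq).
have Mqy : M (q y) by exact: (limit_semigroup_closed clM iM Eq My).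
have near_y (B : set Omega) N : nbhs (q y) B -> exists2 n, (N <= n)%N & B (iter n phi w).
  move=> qB; have Uy := ptws_eval_cvg (w := y) Uq.
  have h1 : \forall n \near U, B° (iter n phi y) := Uy _ (nbhs_interior qB).
  have h2 : \forall n \near U, (N <= n)%N by apply: ooU; exists N.
  have [n [/= Bn Nn]] := filter_ex (filterI h1 h2).
  have /(cont_iter cphi) nB : nbhs (iter n phi y) B by exact: Bn.
  have [_ [[m _ <-] Bm]] := MO _ My _ nB.
  exists (n + m)%N; first by rewrite (leq_trans Nn)// leq_addr.
  by rewrite iterD.
pose F := filter_from (fun BN : set Omega * nat => nbhs (q y) BN.1)
  (fun BN => [set n | (BN.2 <= n)%N /\ BN.1 (iter n phi w)]).
have FF : ProperFilter F.
  apply: filter_from_proper => [|[B N] /= pB]; last first.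
    by have [n ? ?] := near_y B N pB; exists n.
  apply: filter_from_filter; first by exists (setT, 0%N); exact: filterT.
  move=> [B k] [C N] /= pB pC; exists (B `&` C, maxn k N); first exact: filterI.
  by move=> n [] /=; rewrite geq_max => /andP[? ?] [? ?].
have [V [VV FV]] := ultraFilterLemma FF.
have ooV : \oo `<=` V.
  move=> A [N _ NA]; apply: FV; exists (setT, N); first exact: filterT.
  by move=> n [/= Nn _]; exact: NA.
have [p Vp] := compact_ultra_cvg itw VV compact_ptws.
have {}Vp t : iter n phi t @[n --> V] --> p t by exact: (ptws_eval_cvg Vp).
exists p; first exact: (ultra_limit_semigroup VV ooV).
suff -> : p w = q y by [].
have VFV : ProperFilter (iter n phi w @[n --> V]) by exact: fmap_proper_filter.
apply: (@metric_hausdorff _ Omega) => A B pA qB.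
have h : V [set n | B (iter n phi w)] by apply: FV; exists (B, 0%N) => // n [].
have h' : V [set n | A (iter n phi w)] := Vp w _ pA.
by have [n [? ?]] := filter_ex (filterI h' h); exists (iter n phi w).
Qed.

(* Auslander--Ellis, through an idempotent (Ellis--Numakura) of the closed
   semigroup of all [p] in [E] sending [w] into [M]. *)
Lemma minimal_proximal w M : minimal_set phi M -> M `<=` orbit_closure w ->
  exists2 y, M y & forall e, 0 < e ->
    exists n, mdist (iter n phi w) (iter n phi y) < e.
Proof.
move=> minM MO; have [clM _ iM _] := minM.
have [p0 Ep0 Mp0] := minimal_visited minM MO.
pose P (S : set W) := [/\ closed S, S !=set0, S `<=` E &
  forall p q, S p -> S q -> S (p \o q)].
pose L : set W := E `&` [set p | M (p w)].
have PL : P L.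
  split=> //.
  - apply: closedI; first exact: closed_limit_semigroup.
    by apply: closed_comp => // p _; exact: ptws_eval_continuous.
  - by exists p0.
  - by move=> p [].
  - move=> p q [Ep _] [Eq Mq]; split; first exact: limit_semigroup_comp.
    exact: (limit_semigroup_closed clM iM Ep Mq).
have [S [[clS [u Su] SE Scomp] SL Smin]] : exists A, [/\ P A, A `<=` L &
    forall B, P B -> B `<=` A -> A `<=` B].
  apply: (closed_zorn compact_ptws _ _ PL) => [A []//|F [A FA] FP capF].
  split=> //; first by apply: closed_bigI => B /FP[].
    by move=> p /(_ _ FA); have [_ _ + _] := FP _ FA; apply.
  move=> p q Fp Fq B FB; have [_ _ _] := FP _ FB; apply; [exact: Fp|exact: Fq].
have cS : compact S by exact: (subclosed_compact clS compact_ptws).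
(* [S u] is again a closed subsemigroup inside [S], so minimality yields [v] in [S] with
   [v u = u]. *)
pose Sru : set W := [set (p \o u : W) | p in S].
have SSu : S `<=` Sru.
  apply: Smin; last by move=> _ [p Sp <-]; exact: Scomp.
  split.
  - apply: (compact_closed hausdorff_ptws); apply: continuous_compact cS.
    by apply: continuous_subspaceT; exact: ptws_compr_continuous.
  - by exists (u \o u), u.
  - by move=> _ [p Sp <-]; apply: SE; exact: Scomp.
  - move=> _ _ [p Sp <-] [q Sq <-]; exists (p \o u \o q) => //.
    by apply: (Scomp (p \o u) q) => //; exact: Scomp.
have [v Sv vu] := SSu u Su.
(* The elements [p] of [S] with [p u = u] form a closed subsemigroup containing [v]; by minimality
   it contains [u], which is thus idempotent. *)
pose Su' : set W := S `&` [set p : W | (p \o u : W) = u].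
have SSu' : S `<=` Su'.
  apply: Smin; last by move=> p [].
  split.
  - apply: closedI => //.
    have c1 : closed [set (u : W)].
      exact: (compact_closed hausdorff_ptws (@compact_set1 W u)).
    apply: (@closed_comp W W (fun p : W => p \o u : W) [set (u : W)]) => // p _.
    exact: ptws_compr_continuous.
  - by exists v.
  - by move=> p [/SE].
  - move=> p q [Sp pu] [Sq qu]; split; first exact: Scomp.
    by rewrite /= -[p \o q \o u]/(p \o (q \o u)) qu.
have [_ uu] := SSu' u Su.
(* Since [u (u w) = u w], the orbits of [w] and of [u w] approach the same point along [U]. *)
exists (u w); first by have [] := SL u Su.
move=> e e0; have [U [UU _ Uu]] := limit_semigroup_ultra (SE u Su).
have uuw : u (u w) = u w by rewrite -[RHS](congr1 (fun p : W => p w) uu).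
have e2 : 0 < e / 2 by lra.
have h1 : \forall n \near U, ball (u w) (e / 2) (iter n phi w).
  exact: (Uu w _ (nbhsx_ballx (u w) _ e2)).
have h2 : \forall n \near U, ball (u w) (e / 2) (iter n phi (u w)).
  by have := Uu (u w) _ (nbhsx_ballx (u (u w)) _ e2); rewrite uuw.
have [n []] := filter_ex (filterI h1 h2).
rewrite /= => b1 b2; exists n.
have := ball_splitr b1 b2.
by rewrite ballEmdist.
Qed.

Hypothesis eqvP : RelationClasses.Equivalence (fun w1 w2 =>
  inf (range (fun n => mdist (iter n phi w1) (iter n phi w2))) = 0).

(** [w] is proximal to some [y1] in [M1] and some [y2] in [M2], hence [y1] to [y2] by transitivity.
    Limits along times at which their orbits come together give a common point, and minimality of
    [M1] concludes. *)
Lemma orbit_closure_unique_minimal w M1 M2 : minimal_set phi M1 ->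
  minimal_set phi M2 -> M1 `<=` orbit_closure w -> M2 `<=` orbit_closure w ->
  M1 `<=` M2.
Proof.
move=> min1 min2 M1O M2O.
have [y1 My1 /proximalP wy1] := minimal_proximal min1 M1O.
have [y2 My2 /proximalP wy2] := minimal_proximal min2 M2O.
have /proximalP y12 : inf (range (fun n =>
    mdist (iter n phi y1) (iter n phi y2))) = 0.
  apply: (RelationClasses.Equivalence_Transitive y1 w y2) => //.
  exact: (RelationClasses.Equivalence_Symmetric w y1).
have [cl1 _ i1 m1] := min1; have [cl2 _ i2 m2] := min2.
have /choice[n nP] : forall k : nat, exists n,
    mdist (iter n phi y1) (iter n phi y2) < k.+1%:R^-1.
  by move=> k; exact: y12.
have [U [UU ooU]] := ultra_oo.
have [z1 Uz1] := compact_ultra_cvg (fun k => iter (n k) phi y1) UU cO.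
have [z2 Uz2] := compact_ultra_cvg (fun k => iter (n k) phi y2) UU cO.
have Mz1 : M1 z1.
  by apply: (closed_cvg _ cl1 _ _ Uz1); apply: filterE => k; exact: invariant_iter.
have Mz2 : M2 z2.
  by apply: (closed_cvg _ cl2 _ _ Uz2); apply: filterE => k; exact: invariant_iter.
have z12 : z1 = z2.
  apply: (@metric_hausdorff _ Omega) => A B /nbhs_ballP[e /= e0 eA] zB.
  have e2 : 0 < e / 2 by lra.
  have h1 : \forall k \near U, ball z1 (e / 2) (iter (n k) phi y1).
    exact: (Uz1 _ (nbhsx_ballx z1 _ e2)).
  have h2 : \forall k \near U, B (iter (n k) phi y2) := Uz2 _ zB.
  have h3 : \forall k \near U, k.+1%:R^-1 < e / 2.
    by apply: ooU; exact: near_infty_natSinv_lt (PosNum e2).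
  have [k [/= k1 [k2 k3]]] := filter_ex (filterI h1 (filterI h2 h3)).
  exists (iter (n k) phi y2); split=> //; apply: eA.
  apply: (ball_split k1); rewrite ballEmdist /=.
  by apply: lt_trans k3; exact: nP.
apply: subset_trans (_ : M1 `<=` M1 `&` M2) _; last by move=> x [].
apply: m1; [exact: closedI|by exists z1; split=> //; rewrite z12| |by move=> x []].
by move=> x [? ?]; split; [exact: i1|exact: i2].
Qed.

(** Let [J] be a minimal closed subset of [E] stable under composition with [phi]. For [z] in the
    orbit closure of [w], the minimal sets [J z] lie there, hence coincide, and one [p] in [J]
    serves every [z]. *)
Lemma orbit_closure_minimal w : exists M (p : W),
  [/\ minimal_set phi M, M `<=` orbit_closure w, E p
    & forall z, orbit_closure w z -> M (p z)].
Proof.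
have [J [clJ [p Jp] iJ Jmin] JE] := minimal_set_ex compact_ptws
  closed_limit_semigroup limit_semigroup_neq0 limit_semigroup_compl.
have cJ : compact J by exact: (subclosed_compact clJ compact_ptws).
pose Jz z := [set q z | q in J].
(* Minimality passes from [J] to [J z] by pulling a closed invariant [N] back under evaluation at
   [z]. *)
have minJz z : minimal_set phi (Jz z).
  split.
  - apply: (compact_closed (@metric_hausdorff _ Omega)); apply: continuous_compact cJ.
    by apply: continuous_subspaceT; exact: ptws_eval_continuous.
  - by exists (p z), p.
  - by move=> _ [q Jq <-]; exists (phi \o q) => //; exact: iJ.
  - move=> N clN [x0 Nq0] iN NJz.
    have [q0 Jq0 q0z] := NJz _ Nq0.
    move=> _ [q Jq <-].
    have /(_ q Jq)[] // : J `<=` J `&` [set q : W | N (q z)].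
    apply: Jmin.
    + by apply: closedI => //; apply: closed_comp => // r _; exact: ptws_eval_continuous.
    + by exists q0; split=> //=; rewrite q0z.
    + by move=> r [Jr Nr]; split; [exact: iJ|exact: iN].
    + by move=> r [].
have JzO z : orbit_closure w z -> Jz z `<=` orbit_closure w.
  move=> Oz _ [q Jq <-].
  apply: (limit_semigroup_closed (@closed_orbit_closure w) _ (JE _ Jq) Oz).
  exact: orbit_closure_invariant.
exists (Jz w), p; split=> //; first by apply: JzO; exact: orbit_closure_self.
  exact: JE.
move=> z Oz; apply: (orbit_closure_unique_minimal (minJz z) (minJz w)).
- exact: JzO.
- by apply: JzO; exact: orbit_closure_self.
- by exists p.
Qed.

(** Both states are carried by the minimal set [M], where [state_minimal_le] applies in both
    directions. *)
Lemma orbit_closure_uniquely_ergodic w mu nu :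
  (forall x : Omega -> R, continuous x -> ~ indep (orb phi x)) ->
  invariant_state phi (orbit_closure w) mu ->
  invariant_state phi (orbit_closure w) nu ->
  forall x : Omega -> R, continuous x -> mu x = nu x.
Proof.
move=> nind smu snu.
have [M [p [minM MO Ep pM]]] := orbit_closure_minimal w.
have [U [UU ooU Up]] := limit_semigroup_ultra Ep.
have clO := @closed_orbit_closure w.
have onM (la : (Omega -> R) -> R) : invariant_state phi (orbit_closure w) la ->
    invariant_state phi M la.
  move=> sla; have [pla la1 ila] := sla; split=> //.
  have [lD lZ _] := pla; split=> // x cx xM.
  (* The negative part of [x], zero on [M]. Its iterates tend to [y (p z) = 0] on the orbit closure
     along [U], while [la] gives them all the value [la y], which therefore vanishes. *)
  pose y : Omega -> R := (- x) \max cst 0.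
  have cy : continuous y by rewrite /y; cts.
  have y0 z : 0 <= y z by rewrite /y /Order.max_fun le_max lexx orbT.
  have [C yC] := cont_bnd cO cy.
  have yM z : M z -> y z = 0.
    move=> Mz; rewrite /y /Order.max_fun max_r// funN oppr_le0; exact: xM.
  have : ulim U (la \o orb phi y) = 0.
    apply: (@ulim_pf_eq0 _ _ cO _ _ clO pla _ C) => //.
    - by move=> n; exact: cont_orb.
    - move=> n z; rewrite y0/=; apply: le_trans (yC (iter n phi z)); exact: ler_norm.
    - exact: nind.
    - move=> z Oz; rewrite -(yM _ (pM z Oz)).
      by apply: continuous_cvg; [exact: cy|exact: Up].
  rewrite (_ : la \o orb phi y = fun=> la y); last first.
    by apply/funext => n /=; rewrite (state_orb cphi _ sla).
  rewrite ulim_cst => ly0.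
  rewrite -oppr_le0 -(pfN pla)// -ly0; apply: (le_pf pla) => // [|z _].
    by cts.
  by rewrite /y /Order.max_fun le_max lexx.
move=> x cx; apply/eqP; rewrite eq_le.
rewrite (state_minimal_le cO cphi minM (onM _ snu) (onM _ smu) cx (nind _ cx)).
by rewrite (state_minimal_le cO cphi minM (onM _ smu) (onM _ snu) cx (nind _ cx)).
Qed.

End enveloping.

(** * Bounded functionals *)

(** Otherwise the complement of [P] is compatible with [F], and some ultrafilter contains both. *)
Lemma near_ultra I (F : set_system I) (P : set I) : ProperFilter F ->
  (forall U : set_system I, UltraFilter U -> F `<=` U -> U P) -> F P.
Proof.
move=> FF h; apply: contrapT => nFP.
have GF : ProperFilter (filter_from F (fun A => A `&` ~` P)).
  apply: filter_from_proper => [|A FA].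
    apply: filter_from_filter; first by exists setT; exact: filterT.
    move=> A B FA FB; exists (A `&` B); first exact: filterI.
    by move=> x [[]].
  apply: contrapT => AP; apply: nFP; apply: filterS FA => x Ax.
  by apply: contrapT => nPx; apply: AP; exists x.
have [U [UU GU]] := ultraFilterLemma GF.
have UP : U P by apply: h => // A FA; apply: GU; exists A => // x [].
have UnP : U (~` P) by apply: GU; exists setT; [exact: filterT|move=> x []].
by have [x []] := filter_ex (filterI UP UnP).
Qed.

(** The Riesz decomposition by clipping, the pointwise source of additivity of the variation. *)
Lemma clip_le (R : realDomainType) (z f g : R) : 0 <= f -> 0 <= g ->
  `|z| <= f + g -> `|Num.max (- f) (Num.min z f)| <= f /\
    `|z - Num.max (- f) (Num.min z f)| <= g.
Proof.
move=> f0 g0; rewrite !ler_norml => zfg.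
case: (lerP z f) => h1; first by case: (lerP (- f) z) => h2; split; lra.
by case: (lerP (- f) f) => h2; split; lra.
Qed.

Section bounded_functionals.
Context {R : realType} {T : topologicalType}.
Hypothesis cT : compact [set: T].
Implicit Types (f g h z : T -> R).

Definition bounded_functional (B : R) (m : (T -> R) -> R) :=
  [/\ forall f g, continuous f -> continuous g -> m (f + g) = m f + m g,
      forall c f, continuous f -> m (c *: f) = c * m f
    & forall c f, continuous f -> 0 <= c -> (forall w, `|f w| <= c) ->
        `|m f| <= B * c].

Section variation.
Variables (B : R) (m : (T -> R) -> R).
Hypothesis bm : bounded_functional B m.

Let mD f g : continuous f -> continuous g -> m (f + g) = m f + m g.
Proof. by case: bm => + _ _; apply. Qed.

Let mZ c f : continuous f -> m (c *: f) = c * m f.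
Proof. by case: bm => _ + _; apply. Qed.

Let S f := [set m z | z in [set z | continuous z /\ forall w, `|z w| <= f w]].
Let V f := sup (S f).

Let S_in f z : continuous z -> (forall w, `|z w| <= f w) -> S f (m z).
Proof. by move=> cz zf; exists z. Qed.

Let S_sup f : continuous f -> (forall w, 0 <= f w) -> has_sup (S f).
Proof.
move=> cf f0; have [c fc] := cont_bnd cT cf; split.
  by exists (m (cst 0)); apply: S_in => [|w]; [exact: cont_cst|rewrite normr0].
exists (B * `|c|) => _ [z [cz zf] <-]; apply: le_trans (ler_norm _) _.
case: bm => _ _; apply => // w; apply: le_trans (zf w) _.
apply: le_trans (ler_norm _) _; apply: le_trans (fc w) _; exact: ler_norm.
Qed.

Let V_ub f z : continuous f -> continuous z -> (forall w, `|z w| <= f w) -> m z <= V f.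
Proof.
move=> cf cz zf; apply: ub_le_sup; last exact: S_in.
by case: (S_sup cf _) => // w; exact: le_trans (zf w).
Qed.

Let V_le f c : continuous f -> (forall w, 0 <= f w) ->
  (forall z, continuous z -> (forall w, `|z w| <= f w) -> m z <= c) -> V f <= c.
Proof.
move=> cf f0 h; apply: ge_sup; first by case: (S_sup cf f0).
by move=> _ [z [cz zf] <-]; exact: h.
Qed.

Let V_adh f e : continuous f -> (forall w, 0 <= f w) -> 0 < e ->
  exists z, [/\ continuous z, forall w, `|z w| <= f w & V f - e < m z].
Proof.
move=> cf f0 e0; have [_ [z [cz zf] <-] lt] := sup_adherent e0 (S_sup cf f0).
by exists z.
Qed.

(** Clipping splits any [z] dominated by [f + g]; conversely, near-optimal functions for [f] and for
    [g] add up. *)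
Let VD f g : continuous f -> continuous g -> (forall w, 0 <= f w) ->
  (forall w, 0 <= g w) -> V (f + g) = V f + V g.
Proof.
move=> cf cg f0 g0; have cfg : continuous (f + g) by cts.
apply/eqP; rewrite eq_le; apply/andP; split.
  apply: V_le => // [w|z cz zfg]; first by rewrite addr_ge0.
  pose z1 : T -> R := (- f) \max (z \min f).
  have cz1 : continuous z1 by rewrite /z1; cts.
  have -> : z = z1 + (z - z1) by rewrite addrCA subrr addr0.
  rewrite mD//; last by cts.
  apply: lerD; apply: V_ub => //; first by move=> w; have [] := clip_le (f0 w) (g0 w) (zfg w).
    by cts.
  by move=> w; have [] := clip_le (f0 w) (g0 w) (zfg w).
apply/ler_addgt0Pr => e e0; have e2 : 0 < e / 2 by lra.
have [z1 [c1 z1f h1]] := V_adh cf f0 e2.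
have [z2 [c2 z2g h2]] := V_adh cg g0 e2.
have : m (z1 + z2) <= V (f + g).
  apply: V_ub => //; first by cts.
  by move=> w; apply: le_trans (ler_normD _ _) _; rewrite lerD.
by rewrite mD//; lra.
Qed.

Let V0 : V (cst 0) = 0.
Proof.
have c0 := @cont_cst R T 0.
have := VD c0 c0 (fun=> lexx _) (fun=> lexx _).
rewrite (_ : _ + _ = cst 0); last by apply/funext => w; rewrite funE addr0.
by lra.
Qed.

Let VZ_le f c : continuous f -> (forall w, 0 <= f w) -> 0 < c -> c * V f <= V (c *: f).
Proof.
move=> cf f0 c0; rewrite mulrC -ler_pdivlMr//; apply: V_le => // z cz zf.
rewrite ler_pdivlMr// mulrC -mZ//; apply: V_ub; [by cts..|move=> w].
by rewrite !funE normrM (gtr0_norm c0) ler_pM2l.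
Qed.

Let VZ f c : continuous f -> (forall w, 0 <= f w) -> 0 <= c -> V (c *: f) = c * V f.
Proof.
move=> cf f0; rewrite le_eqVlt => /predU1P[<-|c0].
  by rewrite mul0r scale0r; exact: V0.
apply/eqP; rewrite eq_le VZ_le// andbT -ler_pdivrMl//.
have ccf : continuous (c *: f) by cts.
have ci : 0 < c^-1 by rewrite invr_gt0.
have := VZ_le ccf (fun w => mulr_ge0 (ltW c0) (f0 w)) ci.
by rewrite scalerA mulVf ?gt_eqF// scale1r.
Qed.

(* The total variation of [m], by the Riesz--Kantorovich formula. *)
Lemma variation_ex : exists lam, posfun setT lam /\
  forall f, continuous f -> `|m f| <= lam (fun w => `|f w|).
Proof.
pose p f : T -> R := f \max cst 0.
have cp f : continuous f -> continuous (p f) by move=> cf; rewrite /p; cts.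
have p0 f w : 0 <= p f w by rewrite /p /Order.max_fun le_max lexx orbT.
have pE f : f = p f - p (- f).
  apply/funext => w; rewrite /p !funE /Order.max_fun !funE /=.
  by case: (lerP (f w)) => ?; case: lerP => ?; lra.
pose lam f := V (p f) - V (p (- f)).
(* [lam f] can be computed from any expression of [f] as a difference of nonnegative continuous
   functions. *)
have key f g h : continuous f -> continuous g -> continuous h ->
    (forall w, 0 <= g w) -> (forall w, 0 <= h w) -> f = g - h -> lam f = V g - V h.
  move=> cf cg ch g0 h0 fE; have cnf := contN cf.
  have : V (p f + h) = V (g + p (- f)).
    congr V; apply: (addIr (- h)); rewrite addrK addrAC -fE {2}[f]pE.
    by rewrite subrK.
  by rewrite !VD//; [rewrite /lam; lra|exact: cp..].
exists lam; split; last first.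
  move=> f cf; have caf : continuous (fun w => `|f w|) by exact: cont_norm.
  have c0 := @cont_cst R T 0.
  rewrite (key _ (fun w => `|f w|) (cst 0))//; last first.
    by apply/funext => w; rewrite !funE subr0.
  rewrite V0 subr0 ler_norml lerNl -mulN1r -mZ// !V_ub//; first by cts.
  by move=> w; rewrite funE normrM normrN1 mul1r.
split=> [f g cf cg|c f cf|f cf f0].
- rewrite (key _ (p f + p g) (p (- f) + p (- g))).
  + by rewrite !VD// /lam; [lra|apply: cp; cts..].
  + by cts.
  + by apply: contD; exact: cp.
  + by apply: contD; apply: cp; cts.
  + by move=> w; rewrite addr_ge0.
  + by move=> w; rewrite addr_ge0.
  + by rewrite {1}[f]pE {1}[g]pE opprD addrACA.
- have cpf := cp _ cf; have cpnf := cp _ (contN cf).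
  have [c0|c0] := leP 0 c.
    rewrite (key _ (c *: p f) (c *: p (- f))).
    + by rewrite !VZ// /lam; lra.
    + by cts.
    + by cts.
    + by cts.
    + by move=> w; rewrite funE mulr_ge0.
    + by move=> w; rewrite funE mulr_ge0.
    + by rewrite -scalerBr -pE.
  have Nc0 : 0 <= - c by rewrite oppr_ge0 ltW.
  rewrite (key _ (- c *: p (- f)) (- c *: p f)).
  + by rewrite !VZ// /lam; lra.
  + by cts.
  + by cts.
  + by cts.
  + by move=> w; rewrite funE mulr_ge0.
  + by move=> w; rewrite funE mulr_ge0.
  + by rewrite -scalerBr scaleNr -scalerN opprB -pE.
- have c0 := @cont_cst R T 0.
  rewrite (key _ f (cst 0))//; last by apply/funext => w; rewrite !funE subr0.
    rewrite V0 subr0; apply: le_trans (_ : m (cst 0) <= _); last first.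
      by apply: V_ub => // w; rewrite normr0 f0.
    have E := mZ 0 c0; rewrite mul0r in E.
    rewrite -{1}E le_eqVlt; apply/orP; left; apply/eqP; congr m.
    by apply/funext => w; rewrite funE mul0r.
  by move=> w; exact: f0.
Qed.

End variation.

Variables (B : R) (m : (T -> R) -> R).
Hypothesis bm : bounded_functional B m.

(** Dominated convergence without measures: the pointwise convergent sequence of the [|g k|] is not
    independent, so [ulim_pf_eq0] applies to the total variation of [m]. *)
Lemma bounded_functional_cvg0 (g : nat -> T -> R) C : (forall k, continuous (g k)) ->
  (forall k w, `|g k w| <= C) -> (forall w, g k w @[k --> \oo] --> 0) ->
  m (g k) @[k --> \oo] --> 0.
Proof.
move=> cg gC g0; have [lam [plam ml]] := variation_ex bm.
apply/cvgrPdist_lt => e e0; apply: near_ultra => U UU ooU.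
pose h k w := `|g k w|.
have ch k : continuous (h k) by apply: cont_norm; exact: cg.
have h0 w : h k w @[k --> \oo] --> 0.
  by rewrite /h -[X in _ --> X](@normr0 _ R); apply: cvg_norm.
have nh : ~ indep h.
  by apply: (cvg_not_indep cT ch) => w; apply/cvg_ex; exists 0; exact: h0.
have hC k w : 0 <= h k w <= C by rewrite normr_ge0 gC.
have hU w : setT w -> h k w @[k --> U] --> 0.
  by move=> _; apply: cvg_trans (h0 w); exact: cvg_app.
have l0 := ulim_pf_eq0 cT closedT plam UU ooU ch hC nh hU.
have bl : bnd (lam \o h).
  by exists (C * lam 1) => k; apply: (pf_bound plam) => // w _; rewrite normr_id gC.
have := near_ulim UU bl e0; rewrite l0; apply: filterS => k /=.
rewrite !sub0r !normrN; apply: le_lt_trans; apply: le_trans (ml _ (cg k)) _.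
exact: ler_norm.
Qed.

(** A Cauchy criterion reducing filters to sequences: if [m (h i)] varied by [e] on every [Fk k],
    bad pairs would give differences contradicting dominated convergence. *)
Lemma bounded_functional_cvg I (F : set_system I) (h : I -> T -> R) C
    (Fk : nat -> set I) : ProperFilter F -> (forall i, continuous (h i)) ->
  (forall i w, `|h i w| <= C) -> (forall k, F (Fk k)) ->
  (forall i j : nat -> I, (forall k, Fk k (i k)) -> (forall k, Fk k (j k)) ->
     forall w, h (i k) w - h (j k) w @[k --> \oo] --> 0) ->
  cvg (m (h i) @[i --> F]).
Proof.
move=> FF ch hC FFk hFk; apply/cauchy_cvgP/cauchy_exP => e e0.
have [k kP] : exists k, forall i j, Fk k i -> Fk k j -> `|m (h i) - m (h j)| < e.
  apply: contrapT => /forallNP np.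
  have /choice[ij ijP] : forall k, exists ij : I * I,
      [/\ Fk k ij.1, Fk k ij.2 & e <= `|m (h ij.1) - m (h ij.2)|].
    move=> k; have /existsNP[i /existsNP[j]] := np k.
    by move=> /not_implyP[? /not_implyP[? /negP]]; rewrite -leNgt; exists (i, j).
  pose g k := h (ij k).1 - h (ij k).2.
  have cg k : continuous (g k) by rewrite /g; cts.
  have gC k w : `|g k w| <= C + C.
    by apply: le_trans (ler_normB _ _) _; rewrite lerD.
  have g0 w : g k w @[k --> \oo] --> 0.
    by apply: hFk => k; case: (ijP k).
  have /cvgrPdist_lt/(_ _ e0)/filter_ex[k] := bounded_functional_cvg0 cg gC g0.
  have [_ _] := ijP k; rewrite sub0r normrN /g.
  have [mD mZ _] := bm.
  have mN : m (- h (ij k).2) = - m (h (ij k).2) by rewrite -scaleN1r mZ// mulN1r.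
  by rewrite mD//; [rewrite mN leNgt => /negP|cts].
have [i0 Fi0] := filter_ex (FFk k).
exists (m (h i0)).
have FkS : Fk k `<=` [set i | ball (m (h i0)) e (m (h i))].
  by move=> i Fi; rewrite /= -ball_normE /=; exact: kP.
exact: filterS FkS (FFk k).
Qed.

End bounded_functionals.

(** * Convergence of averages *)

Section convergence_of_averages.
Context {R : realType} {T : metricType R}.
Hypothesis cT : compact [set: T].
Variable phi : T -> T.
Hypothesis cphi : continuous phi.
Implicit Types (f g : T -> R).

Definition average (A : (T -> R) -> T -> R) := exists m (a : 'I_m -> R) (n : 'I_m -> nat),
  [/\ forall j, 0 <= a j, \sum_j a j = 1
    & forall f, A f = \sum_j a j *: orb phi f (n j)].

Section one_average.
Variable A : (T -> R) -> T -> R.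
Hypothesis avA : average A.

Lemma cont_average f : continuous f -> continuous (A f).
Proof.
case: avA => [m [a [n [_ _ AE]]]] cf; rewrite AE.
by apply: cont_sum => j; apply: contZ; exact: cont_orb.
Qed.

Lemma average_dist f w w' e : (forall n, `|orb phi f n w - orb phi f n w'| <= e) ->
  `|A f w - A f w'| <= e.
Proof.
case: avA => [m [a [n [a0 a1 AE]]]] fe; rewrite AE !fct_sumE -sumrB.
apply: le_trans (ler_norm_sum _ _ _) _; rewrite -[e]mul1r -a1 mulr_suml.
by apply: ler_sum => j _; rewrite !funZ -mulrBr normrM ger0_norm// ler_wpM2l.
Qed.

Lemma average_norm f C : (forall w, `|f w| <= C) -> forall w, `|A f w| <= C.
Proof.
case: avA => [m [a [n [a0 a1 AE]]]] fC w; rewrite AE !fct_sumE.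
apply: le_trans (ler_norm_sum _ _ _) _; rewrite -[C]mul1r -a1 mulr_suml.
by apply: ler_sum => j _; rewrite !funZ normrM ger0_norm// ler_wpM2l// fC.
Qed.

Lemma average_comp f : A (f \o phi) = A f \o phi.
Proof.
case: avA => [m [a [n [a0 a1 AE]]]]; rewrite !AE; apply/funext => w /=.
rewrite !fct_sumE; apply: eq_bigr => j _; rewrite !funZ /orb /=.
by rewrite -iterS iterSr.
Qed.

Lemma average_posfun w : posfun (orbit_closure phi w) (fun f => A f w).
Proof.
case: avA => [m [a [n [a0 a1 AE]]]]; split=> [f g _ _|c f _|f _ f0].
- by rewrite /= !AE !fct_sumE -big_split; apply: eq_bigr => j _; rewrite /= !funZ -mulrDr.
- rewrite /= !AE !fct_sumE mulr_sumr; apply: eq_bigr => j _.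
  by rewrite !funZ mulrCA.
- rewrite AE fct_sumE sumr_ge0// => j _; rewrite funZ mulr_ge0//.
  by apply: f0; apply: subset_closure; exists (n j).
Qed.

Lemma average1 w : A 1 w = 1.
Proof.
case: avA => [m [a [n [a0 a1 AE]]]]; rewrite AE fct_sumE -[RHS]a1.
by apply: eq_bigr => j _; rewrite funZ mulr1.
Qed.

End one_average.

Variables (I : Type) (F : set_system I) (A : I -> (T -> R) -> T -> R).
Hypotheses (FF : ProperFilter F) (avA : forall i, average (A i)).
Hypothesis ergA : forall f w, continuous f ->
  A i f w - A i f (phi w) @[i --> F] --> 0.
Hypothesis ue : forall w mu nu, invariant_state phi (orbit_closure phi w) mu ->
  invariant_state phi (orbit_closure phi w) nu ->
  forall f, continuous f -> mu f = nu f.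

(** Every ultrafilter limit of [g |-> A i g w] is an invariant state on the orbit closure of [w]; by
    unique ergodicity all of them agree. *)
Lemma averages_cvg_pointwise f w : continuous f ->
  exists l : R, A i f w @[i --> F] --> l.
Proof.
move=> cf.
have b1 : bnd (fun i => A i 1 w).
  by exists 1 => i; rewrite average1// normr1.
pose mu U g := ulim U (fun i => A i g w).
have bA g : continuous g -> bnd (fun i => A i g w).
  move=> cg; have [C gC] := cont_bnd cT cg.
  by exists C => i; exact: (average_norm (avA i)).
have st U : UltraFilter U -> F `<=` U ->
    invariant_state phi (orbit_closure phi w) (mu U).
  move=> UU FU.
  have [_ pmu] := posfun_ulim cT UU (fun i => average_posfun (avA i) w) b1.
  split=> //.
    rewrite /mu -[RHS](ulim_cst UU); congr ulim; apply/funext => i.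
    exact: average1.
  move=> g cg.
  have cgp : continuous (g \o phi).
    by move=> v; apply: continuous_comp; [exact: cphi|exact: cg].
  apply/eqP; rewrite -subr_eq0; apply/eqP.
  rewrite /mu -ulimB; [apply: (ulim_eq UU)|exact: bA|exact: bA].
  apply: cvg_trans (_ : - (A i g w - A i g (phi w)) @[i --> F] --> 0).
    rewrite (_ : (fun i => _) = (fun i => - (A i g w - A i g (phi w)))); last first.
      by apply/funext => i; rewrite average_comp// opprB.
    exact: cvg_app.
  by rewrite -[X in _ --> X]oppr0; apply: cvgN; exact: ergA.
have [U0 [UU0 FU0]] := ultraFilterLemma FF.
exists (mu U0 f); apply/cvgrPdist_lt => e e0; apply: near_ultra => U UU FU.
rewrite (ue (st _ UU0 FU0) (st _ UU FU) cf).
exact: (near_ulim UU (bA _ cf)).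
Qed.

(** An average nearly agrees at two points with the same code, so control at countably many
    representatives suffices; [Fk k] handles finitely many of them at a time. *)
Lemma averages_cvg_countable f (c : nat -> T -> nat) B m : continuous f ->
  bounded_functional B m ->
  (forall q w w', c q w = c q w' ->
     forall n, `|orb phi f n w - orb phi f n w'| <= q.+1%:R^-1) ->
  cvg (m (A i f) @[i --> F]).
Proof.
move=> cf bm hc.
have [C fC] := cont_bnd cT cf.
have cA i : continuous (A i f) by exact: (cont_average (avA i)).
have AC i w : `|A i f w| <= C by exact: (average_norm (avA i)).
have [[w0]|nT] := pselect (inhabited T); last first.
  apply: (@bounded_functional_cvg _ _ cT _ _ bm _ _ _ C (fun=> setT)) => //.
    by move=> _; exact: filterT.
  by move=> i j _ _ w; case: (nT (inhabits w)).
have /choice[L AL] : forall w, exists l : R, A i f w @[i --> F] --> l.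
  by move=> w; exact: averages_cvg_pointwise.
(* A representative of each code class; [w0] is a default for values not attained. *)
pose r q l : T := xget w0 [set w | c q w = l].
have rP q w : c q (r q (c q w)) = c q w.
  by have := xgetPex w0 (ex_intro [set w' | c q w' = c q w] w erefl).
pose Fk k := [set i | forall q l : 'I_k,
  `|L (r q l) - A i f (r q l)| < k.+1%:R^-1].
apply: (@bounded_functional_cvg _ _ cT _ _ bm _ _ _ C Fk) => //.
  move=> k; apply: filter_forall => q; apply: filter_forall => l.
  by have /cvgrPdist_lt := AL (r q l); apply; rewrite invr_gt0.
move=> i j Fi Fj w; apply/cvgrPdist_lt => e e0.
have e4 : 0 < e / 4 by lra.
have [q qe] : exists q : nat, q.+1%:R^-1 < e / 4 :> R.
  by have /filter_ex[q] := near_infty_natSinv_lt (PosNum e4); exists q.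
near=> k.
have qk : (q < k)%N by near: k; exists q.+1.
have lk : (c q w < k)%N by near: k; exists (c q w).+1.
have ke : k.+1%:R^-1 < e / 4 by near: k; exact: near_infty_natSinv_lt (PosNum e4).
have h1 := average_dist (avA (i k)) (hc _ _ _ (rP q w)).
have h2 := average_dist (avA (j k)) (hc _ _ _ (rP q w)).
have h3 := Fi k (Ordinal qk) (Ordinal lk).
have h4 := Fj k (Ordinal qk) (Ordinal lk).
move: qe ke h1 h2 h3 h4; rewrite /= sub0r normrN !ltr_norml !ler_norml.
by move: (q.+1%:R^-1) (k.+1%:R^-1) => u v; lra.
Unshelve. all: by end_near. Qed.

End convergence_of_averages.

Lemma averages_cvg_seq (R : realType) (T : metricType R) (phi : T -> T)
    (A : nat -> (T -> R) -> T -> R) (f : T -> R) B m :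
  compact [set: T] -> continuous phi -> (forall i, average phi (A i)) ->
  (forall w, exists l : R, A i f w @[i --> \oo] --> l) -> continuous f ->
  bounded_functional B m -> cvg (m (A i f) @[i --> \oo]).
Proof.
move=> cT cphi avA /choice[L AL] cf bm.
have [C fC] := cont_bnd cT cf.
apply: (@bounded_functional_cvg _ _ cT _ _ bm _ _ _ C (fun k => [set i | (k <= i)%N])).
- by move=> i; exact: (cont_average cphi (avA i)).
- by move=> i w; exact: (average_norm (avA i)).
- by move=> k; exists k.
- move=> i j ik jk w; rewrite -(subrr (L w)).
  have sub (n : nat -> nat) : (forall k, (k <= n k)%N) ->
      A (n k) f w @[k --> \oo] --> L w.
    move=> nk; apply: (cvg_comp n (fun k => A k f w) _ (AL w)).
    move=> S [N _ NS]; exists N => // k Nk; apply: NS => /=.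
    exact: leq_trans (nk k).
  by apply: cvgB; exact: sub.
Qed.

(** * Countable codes from a metrizable enveloping semigroup *)

Section codes.
Context {R : realType} {Omega : metricType R}.
Hypothesis cO : compact [set: Omega].
Variable phi : continuousType Omega Omega.

(** Cantor's diagonal argument, with [D] true at the codes of sequences that are false at their own
    code. *)
Lemma not_injective_nat (c : (nat -> bool) -> nat) :
  exists s s' i, [/\ c s = c s', s i & ~~ s' i].
Proof.
apply: contrapT => h.
have inj s s' : c s = c s' -> s = s'.
  move=> css; apply/funext => i; apply: contrapT => ne; apply: h.
  case si: (s i) ne; case s'i: (s' i) => // _.
    by exists s, s', i; rewrite s'i.
  by exists s', s, i; rewrite si.
pose D n := `[< exists s, c s = n /\ ~~ s n >].
have [Dn|Dn] := boolP (D (c D)).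
  by have /asboolP[s [/inj -> nD]] := Dn; rewrite Dn in nD.
by move/asboolP : (Dn); apply; exists D.
Qed.

(** Two of the uncountably many patterns must share a class, yet they force a gap of [b - a] at an
    index where they differ. *)
Lemma code_not_indep (f : Omega -> R) (c : nat -> Omega -> nat) : continuous f ->
  (forall q w w', c q w = c q w' ->
     forall n, `|orb phi f n w - orb phi f n w'| <= q.+1%:R^-1) ->
  ~ indep (orb phi f).
Proof.
move=> cf hc.
have cphi : continuous phi by exact: cts_fun.
have cof n : continuous (orb phi f n) by exact: cont_orb.
move=> /(indep_compact cO cof)[a [b [n [ab _ fs]]]].
have [x xP] := choice fs.
have ab0 : 0 < b - a by lra.
have [q qe] : exists q : nat, q.+1%:R^-1 < b - a :> R.
  by have /filter_ex[q] := near_infty_natSinv_lt (PosNum ab0); exists q.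
have [s [s' [i [css si s'i]]]] := not_injective_nat (c q \o x).
have := hc q _ _ css (n i); have := xP s i; have := xP s' i.
rewrite si (negbTE s'i) ler_norml; move: qe.
by move: (q.+1%:R^-1) => u; lra.
Qed.

(** Evaluation at [w] is continuous on the compact metrizable semigroup, so a modulus of uniform
    continuity and rounded values on a finite net determine it up to [e]. These data are countable,
    and the iterates of [phi] are points of the semigroup. *)
Lemma ordinary_code (f : Omega -> R) : continuous f -> ordinary phi ->
  exists c : nat -> Omega -> nat, forall q w w', c q w = c q w' ->
    forall n, `|orb phi f n w - orb phi f n w'| <= q.+1%:R^-1.
Proof.
move=> cf [d [d0 dI dC dT dN]].
suff /choice[c cP] : forall q, exists c : Omega -> nat, forall w w', c w = c w' ->
    forall n, `|orb phi f n w - orb phi f n w'| <= q.+1%:R^-1 by exists c.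
move=> q; set e := q.+1%:R^-1; have e0 : 0 < e by rewrite invr_gt0.
pose S := set_type (enveloping_semigroup phi).
pose ev (w : Omega) (p : S) : R := f (set_val p w).
have cev w : continuous (ev w).
  move=> p; apply: (cvg_comp (fun r : S => set_val r w) f); last exact: cf.
  apply: (cvg_comp (@set_val _ (enveloping_semigroup phi)) (fun r : {ptws Omega -> Omega} => r w)).
    exact: initial_continuous.
  exact: ptws_eval_continuous.
have cS : compact [set: S].
  rewrite compact_ultra => G GG _.
  have [p Gp] := compact_ultra_cvg (@set_val _ (enveloping_semigroup phi)) GG
    (compact_ptws cO).
  have Ep : enveloping_semigroup phi p.
    apply: (closed_cvg _ (@closed_closure _ _) _ _ Gp).
    by apply: filterE => r; exact: set_valP.
  exists (SigSub (mem_set Ep)); split=> // B [_ /= [[A oA <-] /= Ap AB]].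
  by apply: filterS AB _; apply: Gp; exact: open_nbhs_nbhs.
have nb (p : S) r : 0 < r -> nbhs p [set p' | d p p' < r].
  by move=> r0; rewrite dN; exists r.
have /choice[K KP] : forall w, exists k : nat, forall p p' : S,
    d p p' < k.+1%:R^-1 -> `|ev w p - ev w p'| < e / 4.
  move=> w; apply: contrapT => /forallNP h.
  have /choice[pp ppP] : forall k : nat, exists pp : S * S,
      d pp.1 pp.2 < k.+1%:R^-1 /\ e / 4 <= `|ev w pp.1 - ev w pp.2|.
    move=> k; have /existsNP[p /existsNP[p']] := h k.
    by move=> /not_implyP[? /negP]; rewrite -leNgt; exists (p, p').
  have [U [UU ooU]] := ultra_oo.
  have [p pU] := compact_ultra_cvg (fun k => (pp k).1) UU cS.
  have e8 : 0 < e / 8 by lra.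
  have : nbhs p [set p' | `|ev w p - ev w p'| < e / 8].
    by have /cvgrPdist_lt/(_ _ e8) := cev w p.
  rewrite dN => -[r /= r0 rP].
  have r2 : 0 < r / 2 by lra.
  have h1 : \forall k \near U, d p (pp k).1 < r / 2 by exact: (pU _ (nb p _ r2)).
  have h2 : \forall k \near U, k.+1%:R^-1 < r / 2.
    by apply: ooU; exact: near_infty_natSinv_lt (PosNum r2).
  have [k [/= k1 k2]] := filter_ex (filterI h1 h2).
  have [k3 k4] := ppP k.
  have l1 : d p (pp k).1 < r by lra.
  have l2 : d p (pp k).2 < r.
    have := dT p (pp k).1 (pp k).2; move: k1 k2 k3.
    by move: (k.+1%:R^-1) => u; lra.
  have := rP _ l1; have := rP _ l2; move: k4; rewrite leNgt /= !ltr_norml; lra.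
have /choice[net netP] : forall k : nat, exists s : seq S, forall p,
    exists2 p', p' \in s & d p' p < k.+1%:R^-1.
  move=> k; pose G := filter_from [set: seq S] (fun s => [set s' : seq S | {subset s <= s'}]).
  have GF : ProperFilter G.
    apply: filter_from_proper => [|s _]; last by exists s => x.
    apply: filter_from_filter; first by exists [::].
    move=> s t _ _; exists (s ++ t) => // u stu; split=> x xs; apply: stu;
      by rewrite mem_cat xs ?orbT.
  have hG : \forall s \near G,
      [set: S] `<=` [set p | exists2 p', p' \in s & d p' p < k.+1%:R^-1].
    move/compact_near_coveringP : cS; apply => p _.
    exists ([set p' | d p p' < k.+1%:R^-1], [set s' : seq S | {subset [:: p] <= s'}]).
      by split; [apply: nb; rewrite invr_gt0|exists [:: p]].
    by move=> [p' s'] [/= pp' ps]; exists p => //; apply: ps; rewrite inE.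
  by have [s sP] := @filter_ex _ G GF _ hG; exists s => p; exact: sP.
(* [K w] is recorded so that points with the same code use the same net. *)
pose code w := (K w, [seq Num.floor (ev w p / (e / 4)) | p <- net (K w)]).
exists (pickle \o code) => w w' /(pcan_inj (@pickleK _)) [Kw fw] n.
have En : enveloping_semigroup phi (iter n phi).
  by apply: subset_closure; exists n.
pose pn : S := SigSub (mem_set En).
have [p ps pd] := netP (K w) pn.
have h1 := KP w _ _ pd; rewrite Kw in pd; have h2 := KP w' _ _ pd.
have e4 : 0 < e / 4 by lra.
have h3 : `|ev w p - ev w' p| < e / 4.
  have : Num.floor (ev w p / (e / 4)) = Num.floor (ev w' p / (e / 4)).
    move: fw; rewrite -Kw => /eq_in_map; apply; exact: ps.
  move=> fE.
  have := floor_itv (ev w p / (e / 4)); have := floor_itv (ev w' p / (e / 4)).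
  rewrite fE intrD => /andP[a1 a2] /andP[b1 b2].
  rewrite !ler_pdivlMr// in a1 b1; rewrite !ltr_pdivrMr// in a2 b2.
  by rewrite ltr_norml; lra.
have -> : orb phi f n w = ev w pn by [].
have -> : orb phi f n w' = ev w' pn by [].
move: h1 h2 h3; rewrite !ltr_norml ler_norml; lra.
Qed.

End codes.

(** * Real and complex scalars *)

Section scalars.
Context {R : realType} {s : scalars}.
Local Notation K := (scalarField R s).

(** [emb], [rpart], [ipart] and [iunit] treat both scalar fields at once; over the reals the
    imaginary part and unit are 0. *)
Definition emb : R -> K :=
  match s return R -> scalarField R s with
  | RealScalars => fun r => r
  | ComplexScalars => fun r => (r%:C)%C
  end.

Definition rpart : K -> R :=
  match s return scalarField R s -> R with
  | RealScalars => fun z => z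
  | ComplexScalars => fun z => complex.Re z
  end.

Definition ipart : K -> R :=
  match s return scalarField R s -> R with
  | RealScalars => fun z => 0
  | ComplexScalars => fun z => complex.Im z
  end.

Definition iunit : K :=
  match s return scalarField R s with
  | RealScalars => 0
  | ComplexScalars => ('i)%C
  end.

Lemma embD : {morph emb : a b / a + b}.
Proof. by rewrite /emb; case: s => a b //; rewrite rmorphD. Qed.

Lemma embM : {morph emb : a b / a * b}.
Proof. by rewrite /emb; case: s => a b //; rewrite rmorphM. Qed.

Lemma emb0 : emb 0 = 0.
Proof. by rewrite /emb; case: s. Qed.

Lemma emb1 : emb 1 = 1.
Proof. by rewrite /emb; case: s. Qed.

Lemma embN : {morph emb : a / - a}.
Proof. by rewrite /emb; case: s => a //; rewrite rmorphN. Qed.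

Lemma rpartD : {morph rpart : a b / a + b}.
Proof. by rewrite /rpart; case: s => //= -[a a'] [b b']. Qed.

Lemma ipartD : {morph ipart : a b / a + b}.
Proof.
by rewrite /ipart; case: s => [a b|[a a'] [b b']] //=; rewrite addr0.
Qed.

Lemma rpartN : {morph rpart : a / - a}.
Proof. by rewrite /rpart; case: s => //= -[a a']. Qed.

Lemma ipartN : {morph ipart : a / - a}.
Proof. by rewrite /ipart; case: s => [a|[a a']] //=; rewrite oppr0. Qed.

Lemma rpart_emb r : rpart (emb r) = r.
Proof. by rewrite /rpart /emb; case: s. Qed.

Lemma rpartM r z : rpart (emb r * z) = r * rpart z.
Proof. by rewrite /rpart /emb; case: s z => //= -[a b] /=; rewrite mul0r subr0. Qed.

Lemma ipartM r z : ipart (emb r * z) = r * ipart z.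
Proof.
rewrite /ipart /emb; case: s z => [z|[a b]] /=; first by rewrite mulr0.
by rewrite mul0r addr0.
Qed.

Lemma scalarE z : z = emb (rpart z) + iunit * emb (ipart z).
Proof.
rewrite /ipart /rpart /emb /iunit; case: s z => [z|z] /=.
  by rewrite mul0r addr0.
by rewrite -complexE.
Qed.

Lemma emb_le a b : (emb a <= emb b) = (a <= b).
Proof. by rewrite /emb; case: s => //=; rewrite lecR. Qed.

Lemma emb_lt a b : (emb a < emb b) = (a < b).
Proof. by rewrite /emb; case: s => //=; rewrite ltcR. Qed.

Lemma rpart_le a b : a <= b -> rpart a <= rpart b.
Proof. by rewrite /rpart; case: s a b => //= a b; rewrite lecE => /andP[]. Qed.

Lemma emb_ge0 z : 0 <= z -> z = emb (rpart z).
Proof.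
rewrite /rpart /emb; case: s z => //= -[a b]; rewrite lecE /= => /andP[/eqP-> _] //.
Qed.

Lemma rpart_norm_le z : `|rpart z| <= rpart `|z|.
Proof.
rewrite /rpart; case: s z => //= z.
by have := normc_ge_Re z; rewrite lecE => /andP[].
Qed.

Lemma ipart_norm_le z : `|ipart z| <= rpart `|z|.
Proof.
rewrite /ipart /rpart; case: s z => [z|z]; first by rewrite normr0 normr_ge0.
have := congr1 (@complex.Re R) (normc_def z); rewrite /= => ->.
by rewrite -sqrtr_sqr ler_sqrt ?addr_ge0 ?sqr_ge0// lerDr sqr_ge0.
Qed.

Lemma norm_emb r : `|emb r| = emb `|r|.
Proof.
rewrite /emb; case: s => //.
by rewrite [LHS](normc_def (r%:C)%C) /= expr0n /= addr0 sqrtr_sqr.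
Qed.

Lemma norm_scalarE z : `|z : K| = emb (rpart `|z|).
Proof. by apply: emb_ge0. Qed.

Lemma rpart_real z : z \is Num.real -> z = emb (rpart z).
Proof.
rewrite realE => /orP[/emb_ge0//|]; rewrite -oppr_ge0 => /emb_ge0.
by rewrite rpartN embN => /oppr_inj.
Qed.

Lemma pos_emb (e : K) : 0 < e -> exists2 r, 0 < r & e = emb r.
Proof.
move=> e0; have ee := emb_ge0 (ltW e0); exists (rpart e) => //.
by move: e0; rewrite ee -emb0 emb_lt rpart_emb.
Qed.

Section limits.
Context {I : Type} (F : set_system I).
Hypothesis FF : ProperFilter F.

Lemma cvg_emb (a : I -> R) l : a i @[i --> F] --> l -> emb (a i) @[i --> F] --> emb l.
Proof.
move=> /cvgrPdist_lt al; apply/cvgrPdist_lt => _ /pos_emb[r r0 ->].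
by apply: filterS (al r r0) => i; rewrite -embN -embD norm_emb emb_lt.
Qed.

Lemma cvg_rpart (a : I -> K) l : a i @[i --> F] --> l -> rpart (a i) @[i --> F] --> rpart l.
Proof.
move=> /cvgrPdist_lt al; apply/cvgrPdist_lt => r r0.
have := al (emb r); rewrite -emb0 emb_lt => /(_ r0); apply: filterS => i.
rewrite norm_scalarE emb_lt; apply: le_lt_trans.
by rewrite -rpartN -rpartD rpart_norm_le.
Qed.

End limits.

End scalars.

(** * Operators on the dual of C(Omega) *)

Lemma lipschitz_continuous (K : numFieldType) (E G : normedModType K) (g : E -> G)
  (c : K) : (forall x y, `|g x - g y| <= c * `|x - y|) -> 0 <= c -> continuous g.
Proof.
move=> gc c0 x; apply/cvgrPdist_lt => e e0.
have c1 : 0 < c + 1 by rewrite ltr_wpDl.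
near=> y.
apply: le_lt_trans (gc x y) _.
apply: (@le_lt_trans _ _ ((c + 1) * `|x - y|)).
  by rewrite ler_wpM2r// lerDl.
rewrite mulrC -ltr_pdivlMr//; near: y.
have := nbhsx_ballx x _ (divr_gt0 e0 c1).
by rewrite -ball_normE.
Unshelve. all: by end_near. Qed.

Section operators.
Context {R : realType} {s : scalars} {Omega : metricType R}.
Context {cptO : compact [set: Omega]}.
Variable phi : continuousType Omega Omega.
Local Notation K := (scalarField R s).
Local Notation X := (contfun s cptO).
Local Notation U := (@koopman R Omega phi s cptO).
Local Notation V := (@koopman_adjoint R Omega phi s cptO).

Lemma contfun_emb_subproof (f : Omega -> R) : continuous f ->
  (@emb R s \o f) \in @contfun_pred R s Omega.
Proof. by move=> cf; apply/asboolP => w /=; apply: cvg_emb; exact: cf. Qed.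

(* Junk value [0] on discontinuous functions. *)
Definition contfun_emb (f : Omega -> R) : X :=
  if pselect (continuous f) is left cf then ContFun _ (contfun_emb_subproof cf)
  else 0.

Lemma contfun_embE f w : continuous f -> contfun_emb f w = emb (f w).
Proof. by rewrite /contfun_emb => cf; case: pselect. Qed.

Lemma contfun_ext (x y : X) : (forall w, x w = y w) -> x = y.
Proof. by move=> xy; apply: val_inj; apply/funext => w; exact: xy. Qed.

Lemma contfun_embD f g : continuous f -> continuous g ->
  contfun_emb (f + g) = contfun_emb f + contfun_emb g.
Proof.
move=> cf cg; apply: contfun_ext => w.
rewrite contfun_embE; last by cts.
by rewrite [RHS](_ : _ = contfun_emb f w + contfun_emb g w)// !contfun_embE// embD.
Qed.

Lemma contfun_embZ c f : continuous f ->
  contfun_emb (c *: f) = emb c *: contfun_emb f.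
Proof.
move=> cf; apply: contfun_ext => w.
rewrite contfun_embE; last by cts.
by rewrite [RHS](_ : _ = emb c * contfun_emb f w)// !contfun_embE// embM.
Qed.

Lemma contfun_emb_decomp (x : X) : exists f g, [/\ continuous f, continuous g
  & x = contfun_emb f + iunit *: contfun_emb g].
Proof.
have cx := @contfun_continuous R s Omega cptO x.
have cr : continuous (fun w => rpart (x w)) by move=> w; apply: cvg_rpart; exact: cx.
have ci : continuous (fun w => ipart (x w)).
  move=> w; apply/cvgrPdist_lt => r r0.
  have /cvgrPdist_lt/(_ (emb r)) := cx w; rewrite -emb0 emb_lt => /(_ r0).
  apply: filterS => w'; rewrite norm_scalarE emb_lt; apply: le_lt_trans.
  by rewrite -ipartN -ipartD ipart_norm_le.
exists (fun w => rpart (x w)), (fun w => ipart (x w)); split=> //.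
apply: contfun_ext => w.
by rewrite [RHS](_ : _ = contfun_emb (fun w => rpart (x w)) w +
  iunit * contfun_emb (fun w => ipart (x w)) w)// !contfun_embE// -scalarE.
Qed.

Lemma iter_koopman_emb n f : continuous f ->
  iter n U (contfun_emb f) = contfun_emb (orb phi f n).
Proof.
move=> cf; have cphi : continuous phi by exact: cts_fun.
elim: n => [//|n ih]; rewrite iterS ih; apply: contfun_ext => w.
have co m : continuous (orb phi f m) by exact: cont_orb.
rewrite [LHS](_ : _ = contfun_emb (orb phi f n) (phi w))//.
by rewrite !contfun_embE// /orb /= -iterS iterSr.
Qed.

Lemma iter_koopman_adjoint n (mu : dual X) x : iter n V mu x = mu (iter n U x).
Proof. by elim: n x => [//|n ih] x; rewrite iterS iterSr -ih. Qed.

Lemma iter_koopman_norm n (x : X) : `|iter n U x| <= `|x|.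
Proof.
by elim: n => [//|n ih]; rewrite iterS (le_trans (koopman_norm_le _ _)).
Qed.

Lemma dualD (mu : dual X) x y : mu (x + y) = mu x + mu y.
Proof. by have := dual_linear mu 1 x y; rewrite scale1r mul1r. Qed.

Lemma dual0 (mu : dual X) : mu 0 = 0.
Proof. by apply: (addrI (mu 0)); rewrite -dualD !addr0. Qed.

Lemma dualZ (mu : dual X) a x : mu (a *: x) = a * mu x.
Proof. by have := dual_linear mu a x 0; rewrite dual0 !addr0. Qed.

Lemma dual_sumE (J : Type) (r : seq J) (nu : J -> dual X) x :
  (\sum_(j <- r) nu j) x = \sum_(j <- r) nu j x.
Proof. by elim: r => [|j r ih]; rewrite ?big_nil// !big_cons -ih. Qed.

Lemma G0_pairing (T : dual X -> dual X) : G0 phi T ->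
  exists m (a : 'I_m -> K) (n : 'I_m -> nat),
  [/\ forall j, 0 <= a j, \sum_j a j = 1
    & forall mu x, T mu x = \sum_j a j * mu (iter (n j) U x)].
Proof.
move=> [m [a [u [a0 a1 uV ->]]]].
have /choice[n nu] : forall j, exists n, iter n V = u j.
  by move=> j; have [n _ <-] := uV j; exists n.
exists m, a, n; split=> // mu x.
rewrite fct_sumE dual_sumE; apply: eq_bigr => j _.
by rewrite -iter_koopman_adjoint -nu.
Qed.

Lemma G0_norm (T : dual X -> dual X) mu x : G0 phi T -> `|T mu x| <= `|mu| * `|x|.
Proof.
move=> /G0_pairing[m [a [n [a0 a1 ->]]]].
apply: le_trans (ler_norm_sum _ _ _) _.
rewrite -[leRHS]mul1r -a1 mulr_suml; apply: ler_sum => j _.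
rewrite normrM ger0_norm// ler_wpM2l//; apply: le_trans (le_dualnorm _ _) _.
by rewrite ler_wpM2l ?dualnorm_ge0// iter_koopman_norm.
Qed.

Lemma G0_linear (T : dual X -> dual X) a mu nu x : G0 phi T ->
  T (a *: mu + nu) x = a * T mu x + T nu x.
Proof.
move=> /G0_pairing[m [b [n [_ _ E]]]]; rewrite !E mulr_sumr -big_split/=.
apply: eq_bigr => j _.
rewrite [X in _ * X](_ : _ = a * mu (iter (n j) U x) + nu (iter (n j) U x))//.
by rewrite mulrDr mulrCA.
Qed.

(** Nonnegative coefficients in [K] are real, so their real parts define an average of real
    functions whose adjoint is [T]. *)
Lemma G0_average (T : dual X -> dual X) : G0 phi T -> exists A, average phi A /\
  forall f (mu : dual X), continuous f ->
    T mu (contfun_emb f) = mu (contfun_emb (A f)).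
Proof.
move=> /G0_pairing[m [a [n [a0 a1 E]]]].
have aE j : a j = emb (rpart (a j)) by exact: emb_ge0.
exists (fun f => \sum_j rpart (a j) *: orb phi f (n j)); split.
  exists m, (fun j => rpart (a j)), n; split=> //.
    by move=> j; rewrite -(@emb_le R s) emb0 -aE.
  rewrite -[RHS](@rpart_emb R s) emb1 -a1.
  by rewrite (big_morph _ (@rpartD R s) (_ : rpart 0 = 0))// -(@emb0 R s) rpart_emb.
move=> f mu cf; rewrite E.
have co j : continuous (orb phi f j) by apply: cont_orb => //; exact: cts_fun.
elim: (index_enum _) => [|j r ih].
  rewrite !big_nil (_ : contfun_emb 0 = 0) ?dual0//.
  apply: contfun_ext => w; rewrite contfun_embE ?emb0//; exact: cont_cst.
rewrite !big_cons contfun_embD; [|by cts|by cts].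
by rewrite dualD -ih contfun_embZ// dualZ {1}aE iter_koopman_emb.
Qed.

Lemma dirac_subproof w : (fun x : X => x w) \in @dual_pred R s X.
Proof.
apply/asboolP; split=> //.
apply: (@lipschitz_continuous K X K _ 1) => // x y.
by rewrite mul1r [X in `|X|](_ : _ = (x - y) w)// le_supnorm.
Qed.

Definition dirac_dual w : dual X := Dual (dirac_subproof w).

Lemma dual_parts_bounded (mu : dual X) :
  bounded_functional (rpart `|mu|) (fun f => rpart (mu (contfun_emb f))) /\
  bounded_functional (rpart `|mu|) (fun f => ipart (mu (contfun_emb f))).
Proof.
have bd c f : continuous f -> 0 <= c -> (forall w, `|f w| <= c) ->
    rpart `|mu (contfun_emb f)| <= rpart `|mu| * c.
  move=> cf c0 fc; rewrite -[leRHS](@rpart_emb R s) embM -(emb_ge0 (normr_ge0 mu)).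
  apply: rpart_le; apply: le_trans (le_dualnorm _ _) _.
  rewrite ler_wpM2l ?dualnorm_ge0//; apply: supnorm_le.
    by rewrite -emb0 emb_le.
  by move=> w; rewrite contfun_embE// norm_emb emb_le.
split; split=> [f g cf cg|c f cf|c f cf c0 fc].
- by rewrite contfun_embD// dualD rpartD.
- by rewrite contfun_embZ// dualZ rpartM.
- exact: le_trans (rpart_norm_le _) (bd _ _ cf c0 fc).
- by rewrite contfun_embD// dualD ipartD.
- by rewrite contfun_embZ// dualZ ipartM.
- exact: le_trans (ipart_norm_le _) (bd _ _ cf c0 fc).
Qed.

Section limit_operator.
Context {I : Type} (F : set_system I) (T_ : I -> dual X -> dual X).
Hypotheses (FF : ProperFilter F) (GT : forall i, G0 phi (T_ i)).
Hypothesis T_cvg : forall x mu, exists l, T_ i mu x @[i --> F] --> (l : K).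

Let cvg_norm_le (a : I -> K) (l c : K) : a i @[i --> F] --> l ->
  (forall i, `|a i| <= c) -> `|l| <= c.
Proof.
move=> al ac; rewrite -[c]subr0 -[leLHS]subr0; apply/ler_addgt0Pl => e e0.
have /cvgrPdist_lt/(_ _ e0)/filter_ex[i ie] := al.
rewrite !subr0 -[l](subrK (a i)); apply: le_trans (ler_normD _ _) _.
by rewrite lerD// ltW.
Qed.

(** The limits are bilinear in [x] and [mu], and bounded by [|mu| * |x|] since elements of [G0] are
    contractions; they thus define a bounded operator. *)
Lemma wstaro_convergent_pointwise : wstaro_convergent F T_.
Proof.
have /choice[l lT] : forall xm : X * dual X, exists l, T_ i xm.2 xm.1 @[i --> F] --> (l : K).
  by move=> [x mu]; exact: T_cvg.
have luniq x mu (k : K) : T_ i mu x @[i --> F] --> k -> l (x, mu) = k.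
  by move=> Tk; apply: (cvg_unique _ (lT (x, mu)) Tk); exact: norm_hausdorff.
have llin a x y mu : l (a *: x + y, mu) = a * l (x, mu) + l (y, mu).
  apply: luniq; rewrite (_ : (fun i => _) =
      (fun i => a * T_ i mu x + T_ i mu y)); last first.
    by apply/funext => i; rewrite dualD dualZ.
  apply: cvgD; last exact: (lT (y, mu)).
  by apply: cvgMr; exact: (lT (x, mu)).
have llin2 a x mu nu : l (x, a *: mu + nu) = a * l (x, mu) + l (x, nu).
  apply: luniq; rewrite (_ : (fun i => _) =
      (fun i => a * T_ i mu x + T_ i nu x)); last first.
    by apply/funext => i; rewrite G0_linear.
  apply: cvgD; last exact: (lT (x, nu)).
  by apply: cvgMr; exact: (lT (x, mu)).
have lnorm x mu : `|l (x, mu)| <= `|mu| * `|x|.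
  by apply: cvg_norm_le (lT (x, mu)) _ => i; exact: G0_norm.
have lsub x y mu : l (x, mu) - l (y, mu) = l (x - y, mu).
  rewrite (_ : x - y = -1 *: y + x); last by rewrite scaleN1r addrC.
  by rewrite llin mulN1r addrC.
have ldual mu : (fun x => l (x, mu)) \in @dual_pred R s X.
  apply/asboolP; split=> [a x y|]; first exact: llin.
  apply: (@lipschitz_continuous K X K _ `|mu|) => // x y.
  by rewrite lsub lnorm.
pose T mu : dual X := Dual (ldual mu).
have Tlin : linear T.
  by move=> a mu nu; apply: val_inj; apply/funext => x; exact: llin2.
exists T; last by move=> x mu; exact: (lT (x, mu)).
split=> //.
apply: (@lipschitz_continuous K (dual X) (dual X) T 1) => // mu nu.
rewrite mul1r (_ : T mu - T nu = T (mu - nu)); last first.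
  rewrite (_ : mu - nu = -1 *: nu + mu); last by rewrite scaleN1r addrC.
  by rewrite Tlin scaleN1r addrC.
apply: dualnorm_le => [|x x1]; first exact: dualnorm_ge0.
apply: le_trans (lnorm _ _) _.
by rewrite -[leRHS]mulr1 ler_wpM2l ?dualnorm_ge0.
Qed.

End limit_operator.

Section ergodic_nets.
Context {I : Type} (F : set_system I) (T_ : I -> dual X -> dual X).
Hypotheses (FF : ProperFilter F) (GT : forall i, G0 phi (T_ i)).
Hypothesis ergT : ergodic phi F T_.

(** Splitting both [x] and the values of [mu] into real and imaginary parts reduces the claim to
    averages of real functions. *)
Lemma ergodic_convergent :
  (forall A : I -> (Omega -> R) -> Omega -> R, (forall i, average phi (A i)) ->
    (forall f w, continuous f -> A i f w - A i f (phi w) @[i --> F] --> 0) ->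
    forall f m B, continuous f -> bounded_functional B m ->
      cvg (m (A i f) @[i --> F])) ->
  wstaro_convergent F T_.
Proof.
move=> hA.
have /choice[A AP] := fun i => G0_average (GT i).
have avA i : average phi (A i) by case: (AP i).
have TA i f mu : continuous f -> T_ i mu (contfun_emb f) = mu (contfun_emb (A i f)).
  by case: (AP i) => _; apply.
have cphi : continuous phi by exact: cts_fun.
have ergA f w : continuous f -> A i f w - A i f (phi w) @[i --> F] --> 0.
  move=> cf; have cA i : continuous (A i f) by exact: (cont_average cphi (avA i)).
  (* Testing ergodicity on point masses gives pointwise asymptotic invariance. *)
  have := @ergT (contfun_emb f) (dirac_dual w).
  move=> /cvg_rpart; rewrite -[X in _ --> X]/(rpart 0) -(@emb0 R s) rpart_emb.
  rewrite (_ : (fun i => _) = (fun i => A i f w - A i f (phi w)))//.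
  apply/funext => i; rewrite /pairing /= TA//.
  rewrite [X in rpart X](_ : _ = contfun_emb (A i f) w - contfun_emb (A i f) (phi w))//.
  by rewrite !contfun_embE// rpartD rpartN !rpart_emb.
apply: (wstaro_convergent_pointwise FF GT) => x mu.
have key f : continuous f -> exists l : K, T_ i mu (contfun_emb f) @[i --> F] --> l.
  move=> cf; have [b1 b2] := dual_parts_bounded mu.
  have /cvg_ex[/= l1 h1] := hA A avA ergA f _ _ cf b1.
  have /cvg_ex[/= l2 h2] := hA A avA ergA f _ _ cf b2.
  exists (emb l1 + iunit * emb l2).
  rewrite (_ : (fun i => _) = (fun i => emb (rpart (mu (contfun_emb (A i f)))) +
      iunit * emb (ipart (mu (contfun_emb (A i f)))))); last first.
    by apply/funext => i; rewrite TA// -scalarE.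
  apply: cvgD; first exact: cvg_emb.
  by apply: cvgMr; exact: cvg_emb.
have [f [g [cf cg ->]]] := contfun_emb_decomp x.
have [l1 h1] := key f cf; have [l2 h2] := key g cg.
exists (l1 + iunit * l2).
rewrite (_ : (fun i => _) = (fun i => T_ i mu (contfun_emb f) +
    iunit * T_ i mu (contfun_emb g))); last first.
  by apply/funext => i; rewrite dualD dualZ.
by apply: cvgD => //; exact: cvgMr.
Qed.

End ergodic_nets.

(** Two opposite patterns adapted to the signs of the coefficients give points at which the
    combination differs by at least [b - a], so its norm is at least [(b - a) / 2]. *)
Lemma tame_not_indep (f : Omega -> R) : tame phi s cptO -> continuous f ->
  ~ indep (orb phi f).
Proof.
move=> tamephi cf [a [b [n [ab nh fs]]]].
have cphi : continuous phi by exact: cts_fun.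
(* Tameness speaks of positive indices; the shift by one ensures this. *)
pose n' k := n k.+1.
have n'0 k : (0 < n' k)%N by apply: leq_trans (homo_ge nh k.+1).
have n'h : {homo n' : i j / (i < j)%N} by move=> i j ij; apply: nh.
have [_ glb] := tamephi (contfun_emb f) n' n'0 n'h.
have d0 : 0 < (b - a) / 2 by lra.
suff /glb : lbound [set c : K | exists m (a : 'I_m -> K),
      [/\ forall k, a k \is Num.real, \sum_k `|a k| = 1
        & c = `|\sum_(k < m) a k *: iter (n' k) U (contfun_emb f)|]] (emb ((b - a) / 2)).
  by rewrite -emb0 emb_le leNgt d0.
move=> _ [m [al [alr al1 ->]]]; set z : X := \sum_(k < m) _.
pose r k := rpart (al k).
have alE k : al k = emb (r k) by exact: rpart_real.
have r1 : \sum_k `|r k| = 1.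
  apply: (can_inj (@rpart_emb R s)); rewrite emb1 -al1.
  rewrite (big_morph _ (@embD R s) (@emb0 R s)); apply: eq_bigr => k _.
  by rewrite alE norm_emb.
have zE w : z w = emb (\sum_k r k * f (iter (n' k) phi w)).
  rewrite (big_morph _ (@embD R s) (@emb0 R s)) /z.
  elim: (index_enum _) => [|k q ih]; rewrite ?big_nil// !big_cons -ih.
  rewrite [LHS](_ : _ = al k * iter (n' k) U (contfun_emb f) w +
    (\sum_(k <- q) al k *: iter (n' k) U (contfun_emb f)) w)//.
  rewrite iter_koopman_emb// contfun_embE; last by apply: cont_orb.
  by rewrite alE -embM.
have zN w : `|\sum_k r k * f (iter (n' k) phi w)| <= rpart `|z|.
  rewrite -(@emb_le R s) -norm_emb -zE -(emb_ge0 (normr_ge0 z)).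
  exact: le_supnorm.
(* Because of the shift, coefficient [k] governs pattern position [k.+1]; [false] elsewhere is a
   default. *)
pose sg (t : bool) i := if i is i'.+1 then
  if insub i' is Some k then t (+) (0 <= r k) else false else false.
have [w1 w1P] := fs (sg false) m.+1.
have [w2 w2P] := fs (sg true) m.+1.
have : b - a <= \sum_k r k * f (iter (n' k) phi w1) - \sum_k r k * f (iter (n' k) phi w2).
  rewrite -sumrB -[leLHS]mul1r -r1 mulr_suml; apply: ler_sum => k _.
  have := w1P k.+1 (ltn_ord k); have := w2P k.+1 (ltn_ord k).
  rewrite /sg valK /sep_at /orb /= -/(n' k).
  have [r0|r0] := leP 0 (r k) => /= h2 h1.
    by rewrite ger0_norm// -mulrBr ler_wpM2l//; lra.
  by rewrite ltr0_norm// mulNr -mulrN -mulrBr ler_wnM2l ?(ltW r0)//; lra.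
move=> h; rewrite (emb_ge0 (normr_ge0 z)) emb_le.
by have := zN w1; have := zN w2; rewrite !ler_norml; lra.
Qed.

End operators.

Theorem corollary3p8 (R : realType) (s : scalars) (Omega : metricType R)
    (cptO : compact [set: Omega]) (phi : continuousType Omega Omega) :
  (ordinary phi -> RelationClasses.Equivalence (proximal phi) ->
     forall (I : Type) (le : I -> I -> Prop)
       (T_ : I -> dual (contfun s cptO) -> dual (contfun s cptO)),
       directed le ->
       (forall i, G0 phi (T_ i)) ->
       ergodic phi (tails le) T_ ->
       wstaro_convergent (tails le) T_)
  /\
  (tame phi s cptO -> RelationClasses.Equivalence (proximal phi) ->
     forall T_ : nat -> dual (contfun s cptO) -> dual (contfun s cptO),
       (forall n, G0 phi (T_ n)) ->
       ergodic phi \oo T_ ->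
       wstaro_convergent \oo T_).
Proof.
have cphi : continuous phi by exact: cts_fun.
split=> [ordphi eqvP I le T_ [[i0] le_refl le_trans le_dir] GT ergT|
         tamephi eqvP T_ GT ergT].
- have FF : ProperFilter (tails le).
    apply: filter_from_proper; last by move=> i _; exists i; exact: le_refl.
    apply: filter_from_filter; first by exists i0.
    move=> i j _ _; have [k [ik jk]] := le_dir i j; exists k => // l kl.
    by split; apply: (le_trans _ k).
  apply: (ergodic_convergent FF GT ergT) => A avA ergA f m B cf bm.
  have [c hc] := ordinary_code cptO cf ordphi.
  apply: (averages_cvg_countable cptO cphi FF avA ergA _ cf bm hc).
  move=> w mu nu smu snu g cg.
  apply: (orbit_closure_uniquely_ergodic cptO cphi eqvP _ smu snu cg) => x cx.
  have [cx' hcx] := ordinary_code cptO cx ordphi.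
  exact: (code_not_indep cptO cx hcx).
- apply: (ergodic_convergent _ GT ergT) => A avA ergA f m B cf bm.
  apply: (averages_cvg_seq cptO cphi avA _ cf bm) => w.
  apply: (averages_cvg_pointwise cptO cphi _ avA ergA _ _ cf).
  move=> v mu nu smu snu g cg.
  apply: (orbit_closure_uniquely_ergodic cptO cphi eqvP _ smu snu cg) => x cx.
  exact: (tame_not_indep tamephi cx).
Qed.
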